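(* There is an algorithm that, given a $k$-ASHG or an ASHG-SCC whose valuation values are encoded in unary (so that the maximum absolute value is polynomial in the input size), decides whether it admits an individually rational coalition structure in time $n^{O(\mathrm{vc}(G))}$, where $n$ is the number of agents and $\mathrm{vc}(G)$ is the vertex cover number of the preference graph $G$. The valuations need not be symmetric.
   Context: An additively separable hedonic game (ASHG) has a finite agent set $N$ with $n=|N|$, and for each agent $i$ integer values $v_i(j)$ for all $j\in N$ with $v_i(i)=0$; the utility of $i$ in coalition $C\ni i$ is $\sum_{j\in C}v_i(j)$. The preference graph $G$ is the weighted digraph on $N$ with an arc $ij$ of weight $w(ij)=v_i(j)$ whenever $v_i(j)\neq 0$; its vertex cover number is that of its underlying undirected graph. A $k$-ASHG additionally specifies $k\in\mathbb{N}$ and asks for a partition of $N$ into exactly $k$ nonempty coalitions. An ASHG-SCC additionally specifies $k$ and functions $\mathrm{lb},\mathrm{ub}\colon[k]\to\mathbb{N}$ with $\mathrm{lb}(j)\le\mathrm{ub}(j)$ and asks for a partition $\pi=(\pi_1,\dots,\pi_k)$ of $N$ with $\mathrm{lb}(j)\le|\pi_j|\le\mathrm{ub}(j)$ for all $j$. A coalition structure $\pi$ is individually rational (IR) if every agent $i$ has utility $\sum_{j\in\pi(i)}v_i(j)\ge 0$.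
   Formalization: The time bound is proved as (input length + 2)^{c(vc(G)+1)} on a Turing machine instead of n^{O(vc(G))}: with n and vc(G) fixed, unary values can be arbitrarily long and must be read; the bounds agree (for vc(G) ≥ 1) when the input length is polynomial in n. *)

(* Defs.v *)
From mathcomp Require Import all_boot all_order all_algebra.
From Corelib Require Import BinNums.
Set Implicit Arguments. Unset Strict Implicit. Unset Printing Implicit Defensive.
Import Order.TTheory GRing.Theory Num.Theory.
Local Open Scope ring_scope.

Definition valuation (n : nat) := 'I_n -> 'I_n -> int.

(* A coalition structure with (at most) k labelled coalitions is an
   assignment of a coalition index to every agent. *)
Definition utility n k (v : valuation n) (f : 'I_n -> 'I_k) (i : 'I_n) : int :=
  \sum_(j : 'I_n | f j == f i) v i j.

Definition IR n k (v : valuation n) (f : 'I_n -> 'I_k) : Prop :=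
  forall i : 'I_n, 0 <= utility v f i.

(* k-ASHG: partition into exactly k nonempty coalitions, i.e. a
   surjective labelling by 'I_k. *)
Definition kASHG_has_IR n k (v : valuation n) : Prop :=
  exists f : 'I_n -> 'I_k, (forall j : 'I_k, exists i, f i = j) /\ IR v f.

Definition SCC_has_IR n k (v : valuation n) (lb ub : 'I_k -> nat) : Prop :=
  exists f : 'I_n -> 'I_k,
    (forall j : 'I_k, leq (lb j) #|[set i | f i == j]| && leq #|[set i | f i == j]| (ub j)) /\ IR v f.

Definition is_vc n (v : valuation n) (C : {set 'I_n}) : bool :=
  [forall i : 'I_n, forall j : 'I_n,
     ((v i j != 0) || (v j i != 0)) ==> ((i \in C) || (j \in C))].

Lemma vc_exists n (v : valuation n) :
  exists m, [exists C : {set 'I_n}, is_vc v C && (#|C| == m)].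
Proof.
exists #|[set: 'I_n]|%N; apply/existsP; exists [set: 'I_n].
rewrite eqxx andbT; apply/forallP => i; apply/forallP => j.
by rewrite in_setT implybT.
Qed.

Definition vcn n (v : valuation n) : nat := ex_minn (vc_exists v).

Unset Implicit Arguments.
Record kASHG := MkKASHG {
  ka_n : nat; ka_k : nat; ka_v : valuation ka_n;
  ka_diag : forall i, ka_v i i = 0 }.

Record ASHG_SCC := MkSCC {
  sc_n : nat; sc_k : nat; sc_v : valuation sc_n;
  sc_diag : forall i, sc_v i i = 0;
  sc_lb : 'I_sc_k -> nat; sc_ub : 'I_sc_k -> nat;
  sc_lbub : forall j, leq (sc_lb j) (sc_ub j) }.

Set Implicit Arguments.

Inductive sym := S0 | S1 | Sneg | Ssep.

Definition unary (m : nat) : seq sym := nseq m S1 ++ [:: Ssep].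

Fixpoint pbits (p : positive) : seq sym :=
  match p with
  | xH => [:: S1]
  | xO q => S0 :: pbits q
  | xI q => S1 :: pbits q
  end.

Definition binary (m : nat) : seq sym :=
  match bin_of_nat m with
  | N0 => [::]
  | Npos p => pbits p
  end ++ [:: Ssep].

Definition enc_int (z : int) : seq sym :=
  match z with
  | Posz m => unary m
  | Negz m => Sneg :: unary m.+1
  end.

Definition enc_vals n (v : valuation n) : seq sym :=
  flatten [seq enc_int (v i j) | i <- enum 'I_n, j <- enum 'I_n].

Definition enc_kASHG (I : kASHG) : seq sym :=
  unary (ka_n I) ++ binary (ka_k I) ++ enc_vals (ka_v I).

Definition enc_SCC (I : ASHG_SCC) : seq sym :=
  unary (sc_n I) ++ binary (sc_k I) ++ enc_vals (sc_v I) ++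
  flatten [seq binary (sc_lb I j) ++ binary (sc_ub I j) | j <- enum 'I_(sc_k I)].

Unset Implicit Arguments.
Inductive move := MoveL | MoveR | Stay.

Record TM := MkTM {
  tm_nq : nat;
  tm_ng : nat;
  tm_start : 'I_tm_nq;
  tm_acc : 'I_tm_nq;
  tm_rej : 'I_tm_nq;
  tm_blank : 'I_tm_ng;
  tm_inp : sym -> 'I_tm_ng;
  tm_delta : 'I_tm_nq -> 'I_tm_ng -> 'I_tm_nq * 'I_tm_ng * move }.

Definition tm_wf (M : TM) : Prop :=
  tm_acc M != tm_rej M /\ injective (tm_inp M) /\
  (forall s, tm_inp M s != tm_blank M).

(* configuration: state, tape left of the head (reversed), tape from the head *)
Definition config (M : TM) := ('I_(tm_nq M) * seq 'I_(tm_ng M) * seq 'I_(tm_ng M))%type.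

Definition halted (M : TM) (q : 'I_(tm_nq M)) : bool :=
  (q == tm_acc M) || (q == tm_rej M).

Definition step (M : TM) (c : config M) : config M :=
  let: (q, l, r) := c in
  if halted M q then c else
  let: (q', w, mv) := tm_delta M q (head (tm_blank M) r) in
  let rest := behead r in
  match mv with
  | Stay => (q', l, w :: rest)
  | MoveR => (q', w :: l, rest)
  | MoveL => match l with
             | [::] => (q', [::], w :: rest)
             | a :: l' => (q', l', a :: w :: rest)
             end
  end.

Definition init_config (M : TM) (x : seq sym) : config M :=
  (tm_start M, [::], map (tm_inp M) x).

Definition decides_within (M : TM) (x : seq sym) (t : nat) (P : Prop) : Prop :=
  let: (q, _, _) := iter t (step M) (init_config M x) in
  halted M q /\ (q = tm_acc M <-> P).

(* Main.v *)
Require Import Defs.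
From mathcomp Require Import all_boot all_order all_algebra.
From mathcomp Require Import zify.
Set Implicit Arguments. Unset Strict Implicit. Unset Printing Implicit Defensive.

(** Fix a vertex cover [c] of size [v] and guess the labels [g] of its vertices.  A
    vertex outside the cover only cares about cover vertices, so whether it may join
    coalition [l] depends on [c] and [g] alone, and the game is solved by a dynamic
    program over the agents whose state records the utility and the coalition size of
    every cover vertex together with the number of agents put into coalitions that
    avoid the cover; the latter agents are content wherever they are, so they can be
    distributed at will within the size bounds.  With unary values the state is a
    vector of [2v + 1] digits in a base [beta] polynomial in the input size, adding an
    agent adds a fixed number to it, and there are [beta ^ (2v + 1)] states.

    To obtain a Turing machine, the dynamic program is written in a small functional
    language with bounded loops over the numbers below a bound [B] and bit tables of
    length at most [B]; the running time is then polynomial in [B] whatever the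
    program is.  A program is compiled to a register machine, whose registers are
    marks on the tape.  The machine tries [B = 0, 1, 2, ...] until the program
    certifies that [B] is large enough for some vertex cover, which happens at the
    latest for [B] of order [|x| ^ O(vc)]. *)

(** * Turing machines over finite types *)

(** The vertex cover number is never computed: any cover whose tables fit below [B] certifies [B]. A
    cover of any size gives sound answers and a certified one gives complete answers, so minimality
    enters only in the time bound. A second obstacle is the binary coding of [k] and of the size
    bounds, which may be exponential in the input length. A solvable game has [k] at most [|x|], and
    the size bounds may be cut at [B] because they are only compared with numbers of agents, which
    stay below [B]. The base is [beta = (|x| + 2) ^ 3]: each of the [n] agents adds at most
    [2|x| + 1] to a digit, so summing the weights of all agents produces no carry, and one addition
    of numbers updates the whole state vector. The sizes of the coalitions that avoid the cover are
    not tracked one by one, since that would take up to [k] digits. Their total is enough: sizes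
    that respect all lower and upper bounds exist exactly when the total lies between the sums of
    these bounds. *)

Definition upd (T : Type) (f : nat -> T) (a : nat) (y : T) : nat -> T :=
  fun b => if b == a then y else f b.

Section FinTM.

Variables (Q G : finType) (start acc rej : Q) (blank : G) (inp : sym -> G).
Variable dl : Q -> G -> Q * G * move.

Definition finTM : TM :=
  @MkTM #|Q| #|G| (enum_rank start) (enum_rank acc) (enum_rank rej)
    (enum_rank blank) (fun s => enum_rank (inp s))
    (fun q g => let: (q', w, mv) := dl (enum_val q) (enum_val g) in
                (enum_rank q', enum_rank w, mv)).

Lemma finTM_wf : acc != rej -> injective inp -> (forall s, inp s != blank) ->
  tm_wf finTM.
Proof.
move=> nar inj nb; split; [|split] => /=.
- by rewrite (inj_eq enum_rank_inj).
- by move=> s s' /enum_rank_inj /inj.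
- by move=> s; rewrite (inj_eq enum_rank_inj).
Qed.

(** The tape is a total function on cells, read with the blank as default, so trailing blanks that
    the list omits make no difference. The head position is the length of the left part. *)
Definition represents (c : config finTM) (q : Q) (p : nat) (tp : nat -> G) :=
  [/\ c.1.1 = enum_rank q, size c.1.2 = p &
      forall j, nth (enum_rank blank) (catrev c.1.2 c.2) j = enum_rank (tp j)].

Lemma represents_ext c q p tp tp' :
  tp =1 tp' -> represents c q p tp -> represents c q p tp'.
Proof. by move=> e [h1 h2 h3]; split=> // j; rewrite h3 e. Qed.

(** The truncated predecessor matches a machine that stays where it is when told to move left from
    cell 0. *)
Definition move_pos (mv : move) (p : nat) :=
  match mv with MoveL => p.-1 | MoveR => p.+1 | Stay => p end.

Lemma represents_step c q p tp q' w mv :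
  represents c q p tp -> q != acc -> q != rej -> dl q (tp p) = (q', w, mv) ->
  represents (step finTM c) q' (move_pos mv p) (upd tp p w).
Proof.
case: c => [[q0 l] r] [/= -> sl tpP] nacc nrej hdl.
rewrite /halted /= !(inj_eq enum_rank_inj) (negbTE nacc) (negbTE nrej) /=.
have catE (l1 r1 : seq 'I_#|G|) : catrev l1 r1 = rev l1 ++ r1.
  by rewrite catrevE.
have hd : head (enum_rank blank) r = enum_rank (tp p).
  by rewrite -tpP catE nth_cat size_rev sl ltnn subnn nth0.
rewrite hd !enum_rankK hdl.
have tpE j : nth (enum_rank blank) (catrev l (enum_rank w :: behead r)) j =
             enum_rank (upd tp p w j).
  rewrite /upd; case: eqP => [->|/eqP nj].
    by rewrite catE nth_cat size_rev sl ltnn subnn.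
  rewrite -tpP !catE !nth_cat size_rev sl.
  case: ltnP => // lpj.
  have -> : j - p = (j - p).-1.+1 by lia.
  by rewrite /= nth_behead.
case: mv {hdl} => /=.
- case: l sl tpP tpE => [|a l] /= <- tpP tpE; by split.
- by split=> //=; rewrite sl.
- by split.
Qed.

End FinTM.

(* Symbol codes; 4 stands for the blank beyond the end of the input. *)
Definition sym_code (s : sym) : nat :=
  match s with S0 => 0 | S1 => 1 | Sneg => 2 | Ssep => 3 end.

Definition input (x : seq sym) (p : nat) : nat := nth 4 (map sym_code x) p.

Lemma input_lt5 x p : input x p < 5.
Proof.
rewrite /input; case: (ltnP p (size x)) => h; last by rewrite nth_default ?size_map.
by rewrite (nth_map S0) //; case: (nth _ _ _).
Qed.

(** * Register machines over a read-only input *)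

Inductive test := TLe of nat & nat | TInp of nat & nat | TTab of nat & nat.

Inductive instr :=
| IZero of nat | IInc of nat | ISet of nat & nat & bool
| ITest of test & nat & nat.

Definition store := ((nat -> nat) * (nat -> nat -> bool))%type.

Definition teval (x : seq sym) (s : store) (t : test) : bool :=
  match t with
  | TLe r r' => s.1 r <= s.1 r'
  | TInp r a => input x (s.1 r) == a
  | TTab t r => s.2 t (s.1 r)
  end.

Definition istep (x : seq sym) (i : instr) (pc : nat) (s : store) : nat * store :=
  match i with
  | IZero r => (pc.+1, (upd s.1 r 0, s.2))
  | IInc r => (pc.+1, (upd s.1 r (s.1 r).+1, s.2))
  | ISet t r b => (pc.+1, (s.1, upd s.2 t (upd (s.2 t) (s.1 r) b)))
  | ITest t l1 l2 => (if teval x s t then l1 else l2, s)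
  end.

Definition goto (l : nat) := ITest (TLe 0 0) l l.

Definition test_bound (t : test) : nat :=
  match t with TLe r r' => maxn r r' | TInp r _ => r | TTab t r => maxn t r end.

Definition instr_bound (i : instr) : nat :=
  match i with
  | IZero r | IInc r => r
  | ISet t r _ => maxn t r
  | ITest t _ _ => test_bound t
  end.

Definition cstep x (code : seq instr) (c : nat * store) : nat * store :=
  if c.1 < size code then istep x (nth (goto 0) code c.1) c.1 c.2 else c.

(** * Simulation of a register machine *)

Section Sweep.

Variables (code : seq instr) (res : nat).

Let L := size code.
Let m := maxn res (\max_(i <- code) instr_bound i).

(** A register with value [p] is a mark on cell [p]. A cell therefore stores, besides its input
    symbol, one Boolean per register and one bit per table; the extra Boolean of a letter flags cell
    0, by which the head recognises home. *)
Definition cell := ('I_5 * {ffun 'I_m.+1 -> bool} * {ffun 'I_m.+1 -> bool})%type.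
Definition letter := (bool * cell)%type.

Definition marked (r : nat) (c : cell) : bool := c.1.2 (inord r).
Definition bit (t : nat) (c : cell) : bool := c.2 (inord t).
Definition set_mark (r : nat) (b : bool) (c : cell) : cell :=
  (c.1.1, [ffun j : 'I_m.+1 => if j == inord r then b else c.1.2 j], c.2).
Definition set_bit (t : nat) (b : bool) (c : cell) : cell :=
  (c.1, [ffun j : 'I_m.+1 => if j == inord t then b else c.2 j]).

(** A comparison needs no arithmetic: walking right from home, the head stops at the first of the
    two marks, and [r <= r'] holds exactly when the mark of [r] is there. *)
Definition stops (i : instr) (c : cell) : bool :=
  match i with
  | IZero r | IInc r | ISet _ r _ => marked r c
  | ITest (TLe r r') _ _ => marked r c || marked r' c
  | ITest (TInp r _) _ _ | ITest (TTab _ r) _ _ => marked r c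
  end.

Definition verdict (i : instr) (c : cell) : bool :=
  match i with
  | ITest (TLe r _) _ _ => marked r c
  | ITest (TInp _ a) _ _ => val c.1.1 == a
  | ITest (TTab t _) _ _ => bit t c
  | _ => true
  end.

(** Every instruction is a composition of local edits at the stopping cell, at its right neighbour
    and at cell 0: incrementing moves a mark one cell to the right, resetting erases it and puts it
    back at home. *)
Definition at_stop (i : instr) (c : cell) : cell :=
  match i with
  | IZero r | IInc r => set_mark r false c
  | ISet t r b => set_bit t b c
  | _ => c
  end.

Definition past_stop (i : instr) (c : cell) : cell :=
  if i is IInc r then set_mark r true c else c.

Definition at_home (i : instr) (c : cell) : cell :=
  if i is IZero r then set_mark r true c else c.

Definition target (i : instr) (pc : nat) (b : bool) : nat :=
  if i is ITest _ l1 l2 then if b then l1 else l2 else pc.+1.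

(* [inl None] is the initial state and [inl (Some b)] the halting ones; in
   [inr (pc, ph)] instruction [pc] is being executed: [None] is the walk to the
   right, [Some (true, b)] the step beyond the stopping cell and
   [Some (false, b)] the walk back home, where [b] is the outcome of the test. *)
Definition control := (option bool + 'I_L.+1 * option (bool * bool))%type.

(** All program counters beyond the code are merged into [L], the control state that reads off the
    verdict. *)
Definition run_at (pc : nat) : control := inr (inord (minn pc L), None).

Definition delta (q : control) (a : letter) : control * letter * move :=
  match q with
  | inl None => (run_at 0, (true, (a.2.1.1, [ffun=> true], a.2.2)), Stay)
  | inl (Some _) => (q, a, Stay)
  | inr (pc, None) =>
      if pc < L then
        let i := nth (goto 0) code pc in
        if stops i a.2
        then (inr (pc, Some (true, verdict i a.2)), (a.1, at_stop i a.2), MoveR)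
        else (q, a, MoveR)
      else (inl (Some (marked res a.2)), a, Stay)
  | inr (pc, Some (true, b)) =>
      (inr (pc, Some (false, b)), (a.1, past_stop (nth (goto 0) code pc) a.2), MoveL)
  | inr (pc, Some (false, b)) =>
      let i := nth (goto 0) code pc in
      if a.1 then (run_at (target i pc b), (a.1, at_home i a.2), Stay)
      else (q, a, MoveL)
  end.

(** Beyond cell 0 the initial tape already encodes the store in which every register is 0 and every
    table is false, so starting up means rewriting a single cell. In particular a blank, [raw 4], is
    a correct cell wherever the head has not been. *)
Definition raw (n : nat) : letter := (false, (inord n, [ffun=> false], [ffun=> false])).

Definition code_TM : TM :=
  @finTM control letter (inl None) (inl (Some true)) (inl (Some false))
    (raw 4) (fun s => raw (sym_code s)) delta.

Lemma code_TM_wf : tm_wf code_TM.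
Proof.
have inj a b : a < 5 -> b < 5 -> raw a = raw b -> a = b.
  by move=> ha hb [] /(congr1 val); rewrite /= !inordK.
apply: finTM_wf => //.
- by move=> s s' /inj; case: s; case: s' => //= H; have := H isT isT.
- by move=> s; apply/eqP => /inj; case: s => //= H; have := H isT isT.
Qed.

Definition encode (x : seq sym) (s : store) (p : nat) : letter :=
  (p == 0, (inord (input x p), [ffun r : 'I_m.+1 => s.1 r == p],
            [ffun t : 'I_m.+1 => s.2 t p])).

Let reaches n c q p tp := represents (start := inl None) (acc := inl (Some true))
  (rej := inl (Some false)) (blank := raw 4) (inp := fun s => raw (sym_code s))
  (dl := delta) (iter n (step code_TM) c) q p tp.

Lemma reaches1 n c q p tp q' w mv :
  reaches n c q p tp -> ~~ (if q is inl (Some _) then true else false) ->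
  delta q (tp p) = (q', w, mv) ->
  reaches n.+1 c q' (move_pos mv p) (upd tp p w).
Proof.
move=> h nq hd; rewrite /reaches iterS.
by apply: (represents_step h _ _ hd); move: nq; case: (q) => [[[]|]|].
Qed.

Lemma reaches_ext n c q p tp tp' : tp =1 tp' ->
  reaches n c q p tp -> reaches n c q p tp'.
Proof. exact: represents_ext. Qed.

Lemma updK (T : Type) (tp : nat -> T) p : upd tp p (tp p) =1 tp.
Proof. by move=> j; rewrite /upd; case: eqP => // ->. Qed.

Lemma marked_encode x s r p : r <= m -> marked r (encode x s p).2 = (s.1 r == p).
Proof. by move=> hr; rewrite /marked ffunE inordK. Qed.

Lemma bit_encode x s t p : t <= m -> bit t (encode x s p).2 = s.2 t p.
Proof. by move=> hr; rewrite /bit ffunE inordK. Qed.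

Definition stop_pos (s : store) (i : instr) : nat :=
  match i with
  | IZero r | IInc r | ISet _ r _ => s.1 r
  | ITest (TLe r r') _ _ => minn (s.1 r) (s.1 r')
  | ITest (TInp r _) _ _ | ITest (TTab _ r) _ _ => s.1 r
  end.

Lemma stops_encode x s i p : instr_bound i <= m -> p <= stop_pos s i ->
  stops i (encode x s p).2 = (p == stop_pos s i).
Proof.
case: i => [r|r|t r b|[r r'|r a|t r] l1 l2] /=; rewrite ?geq_max => hb hp.
all: try by rewrite marked_encode // eq_sym.
all: try by case/andP: hb => h1 h2; rewrite marked_encode // eq_sym.
case/andP: hb => h1 h2; rewrite !marked_encode //.
move: hp; rewrite /minn; case: ltnP; move=> *.
  by apply/orP/eqP => [[/eqP|/eqP]|->]; [lia|lia|left].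
by apply/orP/eqP => [[/eqP|/eqP]|->]; [lia|lia|right].
Qed.

Lemma verdict_encode x s i : instr_bound i <= m ->
  verdict i (encode x s (stop_pos s i)).2 =
  if i is ITest t _ _ then teval x s t else true.
Proof.
case: i => [r|r|t r b|[r r'|r a|t r] l1 l2] //=; rewrite ?geq_max => hb.
- by rewrite marked_encode; [rewrite minnC; lia|lia].
- by rewrite /encode /= inordK // input_lt5.
- by rewrite bit_encode; lia.
Qed.

Lemma letter_ext (a b : letter) : a.1 = b.1 -> a.2.1.1 = b.2.1.1 ->
  (forall k, k <= m -> marked k a.2 = marked k b.2) ->
  (forall k, k <= m -> bit k a.2 = bit k b.2) -> a = b.
Proof.
case: a => [h [[c f] g]]; case: b => [h' [[c' f'] g']] /= -> -> hf hg.
congr (_, (_, _, _)); apply/ffunP => k.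
  by have := hf k; rewrite /marked /= inord_val; apply; rewrite -ltnS.
by have := hg k; rewrite /bit /= inord_val; apply; rewrite -ltnS.
Qed.

Lemma marked_set_mark k r b c : k <= m -> r <= m ->
  marked k (set_mark r b c) = if k == r then b else marked k c.
Proof. by move=> hk hr; rewrite /marked ffunE -val_eqE /= !inordK. Qed.

Lemma bit_set_bit k t b c : k <= m -> t <= m ->
  bit k (set_bit t b c) = if k == t then b else bit k c.
Proof. by move=> hk hr; rewrite /bit ffunE -val_eqE /= !inordK. Qed.

Lemma fst_upd (tp : nat -> letter) p w j : w.1 = (tp p).1 ->
  (upd tp p w j).1 = (tp j).1.
Proof. by rewrite /upd; case: eqP => [->|]. Qed.

Lemma sym_upd (tp : nat -> letter) p w j : w.2.1.1 = (tp p).2.1.1 ->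
  (upd tp p w j).2.1.1 = (tp j).2.1.1.
Proof. by rewrite /upd; case: eqP => [->|]. Qed.

Lemma at_stop_sym i c : (at_stop i c).1.1 = c.1.1.
Proof. by case: i => [r|r|t r b|t l1 l2]. Qed.

Lemma past_stop_sym i c : (past_stop i c).1.1 = c.1.1.
Proof. by case: i => [r|r|t r b|t l1 l2]. Qed.

Lemma at_home_sym i c : (at_home i c).1.1 = c.1.1.
Proof. by case: i => [r|r|t r b|t l1 l2]. Qed.

Lemma bit_upd (tp : nat -> letter) p w j k : bit k w.2 = bit k (tp p).2 ->
  bit k (upd tp p w j).2 = bit k (tp j).2.
Proof. by rewrite /upd; case: eqP => [->|]. Qed.

Lemma past_stop_bit i c k : bit k (past_stop i c) = bit k c.
Proof. by case: i => [r|r|t r b|t l1 l2]. Qed.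

Lemma at_home_bit i c k : bit k (at_home i c) = bit k c.
Proof. by case: i => [r|r|t r b|t l1 l2]. Qed.

(** The edits are applied in the order of the walk, each reading what the previous one left. This
    covers the case where the stopping cell is cell 0: resetting a register that is already 0 erases
    its mark and then restores it. *)
Lemma instr_tape x s i pc : instr_bound i <= m ->
  let p := stop_pos s i in
  let t1 := upd (encode x s) p ((encode x s p).1, at_stop i (encode x s p).2) in
  let t2 := upd t1 p.+1 ((t1 p.+1).1, past_stop i (t1 p.+1).2) in
  upd t2 0 ((t2 0).1, at_home i (t2 0).2) =1 encode x (istep x i pc s).2.
Proof.
move=> hb p t1 t2 j.
have e1 k : (t1 k).1 = (k == 0) by rewrite fst_upd.
have e2 k : (t2 k).1 = (k == 0) by rewrite fst_upd /= ?e1.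
have f1 k : (t1 k).2.1.1 = inord (input x k).
  by rewrite sym_upd ?at_stop_sym.
have f2 k : (t2 k).2.1.1 = inord (input x k).
  by rewrite sym_upd /= ?past_stop_sym ?f1.
apply: letter_ext.
- by rewrite fst_upd /= ?e2.
- by rewrite sym_upd /= ?at_home_sym ?f2.
- move=> k hk; rewrite marked_encode //.
  rewrite (fun_if (fun a : letter => marked k a.2)) /=.
  rewrite /t2 /upd /= /t1 /upd /= {e1 e2 f1 f2 t1 t2}.
  case: i @p hb => [r|r|t r b|t l1 l2] /= hb.
  + rewrite !(fun_if (fun a : letter => marked k a.2)) /=.
    rewrite !marked_set_mark // !(fun_if (fun a : letter => marked k a.2)) /=.
    rewrite !marked_set_mark // !marked_encode //.
    by rewrite /upd /=; case: (k =P r) => [?|?]; subst; do ![case: eqP => //= ?; subst]; lia.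
  + rewrite !(fun_if (fun a : letter => marked k a.2)) /=.
    rewrite !marked_set_mark // !(fun_if (fun a : letter => marked k a.2)) /=.
    rewrite !marked_set_mark // !marked_encode //.
    by rewrite /upd /=; case: (k =P r) => [?|?]; subst; do ![case: eqP => //= ?; subst]; lia.
  + rewrite !(fun_if (fun a : letter => marked k a.2)) /=.
    rewrite /set_bit /marked /= ffunE inordK //.
    by rewrite /upd /=; do ![case: eqP => //= ?; subst]; rewrite ?ffunE ?inordK //; lia.
  + rewrite !(fun_if (fun a : letter => marked k a.2)) /= !marked_encode //.
    by rewrite /upd /=; do ![case: eqP => //= ?; subst]; lia.
- move=> k hk; rewrite bit_encode // bit_upd ?at_home_bit // bit_upd ?past_stop_bit //.
  clear e1 e2 f1 f2 t2; rewrite {}/t1 /upd (fun_if (fun a : letter => bit k a.2)) /=.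
  case: i @p hb => [r|r|t r b|t l1 l2] /= hb; rewrite ?bit_encode //.
  + by rewrite [bit k _]bit_encode //; case: eqP => // ->.
  + by rewrite [bit k _]bit_encode //; case: eqP => // ->.
  + rewrite geq_max in hb; case/andP: hb => ht hr.
    rewrite bit_set_bit // bit_encode // /upd.
    by case: (k =P t) => [->|]; case: eqP => // ->.
  + by case: eqP => // ->.
Qed.

Lemma instr_bound_le pc : pc < L -> instr_bound (nth (goto 0) code pc) <= m.
Proof.
rewrite /L /m leq_max => h; apply/orP; right.
by rewrite (big_nth (goto 0)) big_mkord (bigmax_sup (Ordinal h)).
Qed.

(** With [P] the stopping position, the cost [2P + 3] is made of [P] steps to the right, one step
    beyond the stopping cell, one back to it, [P] steps home and one to enter the next
    instruction. *)
Lemma instr_sim n c x pc s : reaches n c (run_at pc) 0 (encode x s) -> pc < L ->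
  let i := nth (goto 0) code pc in
  reaches (n + (stop_pos s i).*2.+3) c (run_at (istep x i pc s).1) 0
          (encode x (istep x i pc s).2).
Proof.
move=> h0 hpc i; set P := stop_pos s i.
have hb : instr_bound i <= m by apply: instr_bound_le.
have run_at_lt : run_at pc = inr (inord pc, None).
  by rewrite /run_at (minn_idPl (ltnW hpc)).
have pcK : (inord pc : 'I_L.+1) = pc :> nat by rewrite inordK // ltnS ltnW.
have right p : p <= P -> reaches (n + p) c (inr (inord pc, None)) p (encode x s).
  elim: p => [|p IH] hp; first by rewrite addn0 -run_at_lt.
  rewrite addnS; apply: reaches_ext (updK _ p) _.
  apply: (reaches1 (mv := MoveR) (IH (ltnW hp))) => //.
  by rewrite /delta pcK hpc stops_encode ?(ltnW hp) // (ltn_eqF hp).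
pose t1 := upd (encode x s) P ((encode x s P).1, at_stop i (encode x s P).2).
pose t2 := upd t1 P.+1 ((t1 P.+1).1, past_stop i (t1 P.+1).2).
pose b := verdict i (encode x s P).2.
have h1 : reaches (n + P).+1 c (inr (inord pc, Some (true, b))) P.+1 t1.
  apply: (reaches1 (mv := MoveR) (right P (leqnn P))) => //.
  by rewrite /delta pcK hpc stops_encode // eqxx.
have h2 : reaches (n + P).+2 c (inr (inord pc, Some (false, b))) P t2.
  by apply: (reaches1 (mv := MoveL) h1) => //; rewrite /delta pcK.
have e2 k : (t2 k).1 = (k == 0) by rewrite fst_upd /= /t1 ?fst_upd.
have left p : p <= P ->
    reaches ((n + P).+2 + p) c (inr (inord pc, Some (false, b))) (P - p) t2.
  elim: p => [|p IH] hp; first by rewrite addn0 subn0.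
  rewrite addnS subnS; apply: reaches_ext (updK _ (P - p)) _.
  apply: (reaches1 (mv := MoveL) (IH (ltnW hp))) => //.
  by rewrite /delta e2 subn_eq0 leqNgt hp.
have := left P (leqnn P); rewrite subnn => h3.
have -> : n + P.*2.+3 = ((n + P).+2 + P).+1 by lia.
apply: reaches_ext (instr_tape x s pc hb) _.
rewrite -/P -/t1 -/t2.
apply: (reaches1 (mv := Stay) h3) => //.
rewrite /delta e2 eqxx pcK -/i; congr (run_at _, _, _).
by rewrite /b verdict_encode //; case: (i).
Qed.

Lemma start_sim x :
  reaches 1 (init_config code_TM x) (run_at 0) 0 (encode x (fun=> 0, fun _ _ => false)).
Proof.
pose tp p : letter := raw (input x p).
have h0 : reaches 0 (init_config code_TM x) (inl None) 0 tp.
  split=> //= j; rewrite /tp /input.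
  case: (ltnP j (size x)) => hj; last by rewrite !nth_default ?size_map.
  by rewrite !(nth_map S0).
apply: (@reaches_ext _ _ _ _ (upd tp 0 (true, ((tp 0).2.1.1, [ffun=> true], (tp 0).2.2)))).
  move=> j; rewrite /upd; case: eqP => [->|/eqP nj].
    by congr (_, (_, _, _)); apply/ffunP => k; rewrite !ffunE.
  rewrite /encode (negbTE nj) /tp /raw; congr (_, (_, _, _)).
  by apply/ffunP => k; rewrite !ffunE eq_sym (negbTE nj).
exact: (reaches1 (mv := Stay) h0).
Qed.

Theorem code_sim x n V c :
  (forall j r, j < n -> (iter j (cstep x code) (0, (fun=> 0, fun _ _ => false))).2.1 r <= V) ->
  iter n (cstep x code) (0, (fun=> 0, fun _ _ => false)) = c -> size code <= c.1 ->
  exists2 t, t <= n * V.*2.+3 + 2 & decides_within code_TM x t (c.2.1 res = 0).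
Proof.
move=> hV hc hL; set s0 := (0, _) in hV hc.
have [t ht ht'] : exists2 t, t <= n * V.*2.+3 + 1 &
    reaches t (init_config code_TM x) (run_at c.1) 0 (encode x c.2).
  rewrite -hc {hc hL}; elim: n hV => [|n IH] hV.
    by exists 1; [|exact: start_sim].
  have [|t ht ht'] := IH; first by move=> j r hj; apply: hV; lia.
  rewrite iterS; set c' := iter n _ _ in ht' *.
  rewrite /cstep; case: ltnP => hlt; last by exists t => //; lia.
  exists (t + (stop_pos c'.2 (nth (goto 0) code c'.1)).*2.+3); last exact: instr_sim.
  suff : stop_pos c'.2 (nth (goto 0) code c'.1) <= V by lia.
  have hV' r : c'.2.1 r <= V by apply: hV.
  case: (nth _ _ _) => [r|r|t0 r b|[r r'|r a|t0 r] l1 l2] //=.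
  by rewrite geq_min hV'.
exists t.+1; first lia.
(* The head is at home when the program ends, so the mark of [res] under the head says whether this
   register is 0. *)
have : reaches t.+1 (init_config code_TM x) (inl (Some (marked res (encode x c.2 0).2))) 0
    (encode x c.2).
  apply: reaches_ext (updK _ 0) _; apply: (reaches1 (mv := Stay) ht') => //.
  rewrite /delta /run_at inordK; last by rewrite ltnS geq_minr.
  by rewrite (minn_idPr hL) ltnn.
rewrite marked_encode; last by rewrite leq_max leqnn.
rewrite /decides_within /reaches.
case: (iter _ _ _) => [[q l] r] [/= -> _ _]; split.
  by rewrite /halted /= !(inj_eq enum_rank_inj); case: (_ == 0).
split=> [/enum_rank_inj [/eqP //]|->]; by rewrite eqxx.
Qed.

End Sweep.

(** * Structured programs *)

Inductive cmd :=
| CZero of nat | CInc of nat | CSet of nat & nat & bool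
| CSeq of cmd & cmd | CIf of test & cmd & cmd | CUntil of test & cmd.

(** The counts are those of the flattened code: a true branch also pays for the jump over the other
    branch, and each round of a loop for its test and for the jump back. *)
Inductive exec (x : seq sym) : cmd -> store -> store -> nat -> Prop :=
| ExZero r s : exec x (CZero r) s (upd s.1 r 0, s.2) 1
| ExInc r s : exec x (CInc r) s (upd s.1 r (s.1 r).+1, s.2) 1
| ExSet t r b s : exec x (CSet t r b) s (s.1, upd s.2 t (upd (s.2 t) (s.1 r) b)) 1
| ExSeq c1 c2 s1 s2 s3 n1 n2 : exec x c1 s1 s2 n1 -> exec x c2 s2 s3 n2 ->
    exec x (CSeq c1 c2) s1 s3 (n1 + n2)
| ExIfT t c1 c2 s s' n : teval x s t -> exec x c1 s s' n ->
    exec x (CIf t c1 c2) s s' n.+2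
| ExIfF t c1 c2 s s' n : ~~ teval x s t -> exec x c2 s s' n ->
    exec x (CIf t c1 c2) s s' n.+1
| ExDone t c s : teval x s t -> exec x (CUntil t c) s s 1
| ExLoop t c s1 s2 s3 n1 n2 : ~~ teval x s1 t -> exec x c s1 s2 n1 ->
    exec x (CUntil t c) s2 s3 n2 -> exec x (CUntil t c) s1 s3 (n1.+2 + n2).

Fixpoint flat_size (c : cmd) : nat :=
  match c with
  | CZero _ | CInc _ | CSet _ _ _ => 1
  | CSeq c1 c2 => flat_size c1 + flat_size c2
  | CIf _ c1 c2 => (flat_size c1 + flat_size c2).+2
  | CUntil _ c => (flat_size c).+2
  end.

Fixpoint flat (c : cmd) (off : nat) : seq instr :=
  match c with
  | CZero r => [:: IZero r]
  | CInc r => [:: IInc r]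
  | CSet t r b => [:: ISet t r b]
  | CSeq c1 c2 => flat c1 off ++ flat c2 (off + flat_size c1)
  | CIf t c1 c2 =>
      ITest t off.+1 (off.+2 + flat_size c1) ::
      flat c1 off.+1 ++
      goto (off + (flat_size c1 + flat_size c2).+2) :: flat c2 (off.+2 + flat_size c1)
  | CUntil t c =>
      ITest t (off.+2 + flat_size c) off.+1 :: flat c off.+1 ++ [:: goto off]
  end.

Lemma size_flat c off : size (flat c off) = flat_size c.
Proof.
elim: c off => [r|r|t r b|c1 IH1 c2 IH2|t c1 IH1 c2 IH2|t c IH] off //=.
- by rewrite size_cat IH1 IH2.
- by rewrite size_cat /= IH1 IH2 addnS.
- by rewrite size_cat IH addn1.
Qed.

Lemma cstep_nth x pre i post s :
  cstep x (pre ++ i :: post) (size pre, s) = istep x i (size pre) s.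
Proof. by rewrite /cstep size_cat /= addnS ltnS leq_addr nth_cat ltnn subnn. Qed.

(** Jump targets are absolute, so the induction runs over arbitrary surrounding code, with the
    length of [pre] as the offset of the fragment. *)
Lemma flat_exec x c s s' n : exec x c s s' n ->
  forall pre post, iter n (cstep x (pre ++ flat c (size pre) ++ post)) (size pre, s) =
                   (size pre + flat_size c, s').
Proof.
elim=> {c s s' n}.
- by move=> r s pre post; rewrite addn1 /= cstep_nth.
- by move=> r s pre post; rewrite addn1 /= cstep_nth.
- by move=> t r b s pre post; rewrite addn1 /= cstep_nth.
- move=> c1 c2 s1 s2 s3 n1 n2 _ IH1 _ IH2 pre post /=.
  rewrite addnC iterD -catA IH1 catA.
  by have := IH2 (pre ++ flat c1 (size pre)) post; rewrite size_cat size_flat addnA.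
- move=> t c1 c2 s s' n ht _ IH pre post; rewrite iterS iterSr /= cstep_nth /= ht -catA /=.
  set i := ITest _ _ _; set g := goto _; set fl := flat c2 _.
  have := IH (rcons pre i) (g :: fl ++ post).
  rewrite size_rcons cat_rcons => ->.
  have -> : pre ++ i :: flat c1 (size pre).+1 ++ g :: fl ++ post =
            (rcons pre i ++ flat c1 (size pre).+1) ++ g :: fl ++ post.
    by rewrite -catA cat_rcons.
  have -> : (size pre).+1 + flat_size c1 = size (rcons pre i ++ flat c1 (size pre).+1).
    by rewrite size_cat size_rcons size_flat.
  by rewrite cstep_nth /= leqnn.
- move=> t c1 c2 s s' n /negbTE ht _ IH pre post; rewrite iterSr /= cstep_nth /= ht.
  set i := ITest _ _ _; set g := goto _.
  have := IH (rcons pre i ++ rcons (flat c1 (size pre).+1) g) post.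
  rewrite size_cat !size_rcons size_flat.
  have -> : (size pre).+1 + (flat_size c1).+1 = (size pre).+2 + flat_size c1 by lia.
  rewrite !cat_rcons -!catA /= cat_rcons /= => ->; congr (_, _); lia.
- move=> t c s ht pre post /=; rewrite cstep_nth /= ht; congr (_, _); lia.
- move=> t c s1 s2 s3 n1 n2 /negbTE ht _ IH1 _ IH2 pre post.
  rewrite addnC iterD.
  suff -> : iter n1.+2 (cstep x (pre ++ flat (CUntil t c) (size pre) ++ post)) (size pre, s1)
            = (size pre, s2) by apply: IH2.
  rewrite iterS iterSr /= cstep_nth /= ht.
  set i := ITest _ _ _.
  have := IH1 (rcons pre i) (goto (size pre) :: post).
  rewrite size_rcons !cat_rcons -catA /= => ->.
  have -> : pre ++ i :: flat c (size pre).+1 ++ goto (size pre) :: post =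
            (rcons pre i ++ flat c (size pre).+1) ++ goto (size pre) :: post.
    by rewrite -catA cat_rcons.
  have -> : (size pre).+1 + flat_size c = size (rcons pre i ++ flat c (size pre).+1).
    by rewrite size_cat size_rcons size_flat.
  by rewrite cstep_nth /= leqnn.
Qed.

(** A step raises a register by at most one. The number of steps thus bounds all register values,
    hence the length of every sweep over the tape, and simulation costs only a square. *)
Lemma cstep_growth x code n r :
  (iter n (cstep x code) (0, (fun=> 0, fun _ _ => false))).2.1 r <= n.
Proof.
elim: n r => // n IH r; rewrite iterS; set c := iter n _ _ in IH *.
rewrite /cstep; case: ifP => _; last exact: leqW.
case: (nth _ _ _) => [r'|r'|t r' b|t l1 l2] /=; try exact: leqW (IH _).
- by rewrite /upd; case: eqP => // _; exact: leqW (IH _).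
- by rewrite /upd; case: eqP => _; [rewrite ltnS IH | exact: leqW (IH _)].
Qed.

Theorem cmd_TM (c : cmd) (res : nat) : exists2 M : TM, tm_wf M &
  forall x s' n, exec x c (fun=> 0, fun _ _ => false) s' n ->
  exists2 t, t <= n * n.*2.+3 + 2 & decides_within M x t (s'.1 res = 0).
Proof.
exists (code_TM (flat c 0) res); first exact: code_TM_wf.
move=> x s' n /flat_exec H; have := H [::] [::]; rewrite /= cats0 add0n => {}H.
have [||t ht ht'] := code_sim res (V := n) _ H.
- by move=> j r hj; apply: leq_trans (cstep_growth _ _ _ _) (ltnW hj).
- by rewrite size_flat.
- by exists t.
Qed.

(** * Expressions with bounded loops *)

(** Variables are positions in [env], and there is one current table. [ELetTab] computes entry [i]
    with the entries before [i] as the current table, which is the recursion of a dynamic program;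
    [EDrop] discards the innermost variables. *)
Inductive expr :=
| EVar of nat
| EZero
| EBound
| ESucc of expr
| EIfLe of expr & expr & expr & expr
| EFold of expr & expr & expr
| EIfInp of nat & expr & expr & expr
| EIfTab of expr & expr & expr
| ELetTab of expr & expr & expr
| ELet of expr & expr
| EDrop of nat & expr.

Fixpoint eval (x : seq sym) (B : nat) (T : seq bool) (env : seq nat) (e : expr) : nat :=
  match e with
  | EVar i => nth 0 env i
  | EZero => 0
  | EBound => B
  | ESucc e => (eval x B T env e).+1
  | EIfLe e1 e2 e3 e4 =>
      if eval x B T env e1 <= eval x B T env e2
      then eval x B T env e3 else eval x B T env e4
  | EFold eN e0 e1 =>
      iteri (minn (eval x B T env eN) B)
        (fun i a => eval x B T (i :: a :: env) e1) (eval x B T env e0)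
  | EIfInp a e e1 e2 =>
      if input x (eval x B T env e) == a then eval x B T env e1 else eval x B T env e2
  | EIfTab e e1 e2 =>
      if nth false T (eval x B T env e) then eval x B T env e1 else eval x B T env e2
  | ELetTab eN e1 e2 =>
      eval x B
        (iteri (minn (eval x B T env eN) B)
           (fun i T' => rcons T' (0 < eval x B T' (i :: env) e1)) [::]) env e2
  | ELet e1 e2 => eval x B T (eval x B T env e1 :: env) e2
  | EDrop k e => eval x B T (drop k env) e
  end.

Definition copy (a f : nat) : cmd := CSeq (CZero f) (CUntil (TLe a f) (CInc f)).

(** Register 0 holds [B], so register [f] becomes its minimum with [B]. The reset of the scratch
    register [f.+1] fills the branch in which nothing is to be done. *)
Definition clip (f : nat) : cmd := CIf (TLe f 0) (CZero f.+1) (copy 0 f).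

Local Notation "c1 ;; c2" := (CSeq c1 c2) (at level 60, right associativity).

(* Register 0 holds [B]; the variables live in the registers [rho], the table in
   the bit track [tt] with its length in register [lr]; the result goes to
   register [f], and registers and tracks below [f] are left unchanged. *)
Fixpoint compile (e : expr) (rho : seq nat) (tt lr f : nat) : cmd :=
  match e with
  | EVar i => if i < size rho then copy (nth 0 rho i) f else CZero f
  | EZero => CZero f
  | EBound => copy 0 f
  | ESucc e => compile e rho tt lr f;; CInc f
  | EIfLe e1 e2 e3 e4 =>
      compile e1 rho tt lr f;; compile e2 rho tt lr f.+1;;
      CIf (TLe f f.+1) (compile e3 rho tt lr f) (compile e4 rho tt lr f)
  | EFold eN e0 e1 =>
      compile eN rho tt lr f;; clip f;; compile e0 rho tt lr f.+1;; CZero f.+2;;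
      CUntil (TLe f f.+2)
        (compile e1 [:: f.+2, f.+1 & rho] tt lr f.+3;; copy f.+3 f.+1;; CInc f.+2);;
      copy f.+1 f
  | EIfInp a e e1 e2 =>
      compile e rho tt lr f;;
      CIf (TInp f a) (compile e1 rho tt lr f) (compile e2 rho tt lr f)
  | EIfTab e e1 e2 =>
      compile e rho tt lr f;;
      CIf (TLe lr f) (compile e2 rho tt lr f)
        (CIf (TTab tt f) (compile e1 rho tt lr f) (compile e2 rho tt lr f))
  | ELetTab eN e1 e2 =>
      compile eN rho tt lr f;; clip f;; CZero f.+1;;
      CUntil (TLe f f.+1)
        (compile e1 (f.+1 :: rho) f f.+1 f.+2;; CZero f.+3;;
         CIf (TLe f.+2 f.+3) (CSet f f.+1 false) (CSet f f.+1 true);; CInc f.+1);;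
      compile e2 rho f f.+1 f.+2;; copy f.+2 f
  | ELet e1 e2 =>
      compile e1 rho tt lr f;; compile e2 (f :: rho) tt lr f.+1;; copy f.+1 f
  | EDrop k e => compile e (drop k rho) tt lr f
  end.

(** * Correctness and cost of compiled expressions *)

Definition frame (f : nat) (s s' : store) :=
  (forall r, r < f -> s'.1 r = s.1 r) /\ (forall t p, t < f -> s'.2 t p = s.2 t p).

(** The track agrees with the table only below its length. Later cells may keep bits of earlier
    tables, which is why a compiled table lookup first compares the index with the length
    register. *)
Definition ready (B : nat) (T : seq bool) (env rho : seq nat) (tt lr f : nat) (s : store) :=
  [/\ 0 < f, s.1 0 = B, all (fun r => r < f) rho & map s.1 rho = env] /\
  [/\ lr < f, tt < f, s.1 lr = size T & forall j, j < size T -> s.2 tt j = nth false T j].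

Lemma frame_trans f s1 s2 s3 : frame f s1 s2 -> frame f s2 s3 -> frame f s1 s3.
Proof.
move=> [h1 h2] [h3 h4]; split=> [r|t p] hr; first by rewrite h3 // h1.
by rewrite h4 // h2.
Qed.

Lemma frame_le f f' s1 s2 : f' <= f -> frame f s1 s2 -> frame f' s1 s2.
Proof. by move=> le [h1 h2]; split=> [r|t p] hr; [apply: h1|apply: h2]; lia. Qed.

Lemma frame_upd f r v s : f <= r -> frame f s (upd s.1 r v, s.2).
Proof. by move=> h; split=> //= r' hr; rewrite /upd; case: eqP => //; lia. Qed.

Lemma ready_frame B T env rho tt lr f s s' :
  ready B T env rho tt lr f s -> frame f s s' -> ready B T env rho tt lr f s'.
Proof.
move=> [[f0 hB hr he] [hl ht hs hT]] [h1 h2]; split; split=> //.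
- by rewrite h1.
- rewrite -he; apply/eq_in_map => r /(allP hr); exact: h1.
- by rewrite h1.
- by move=> j hj; rewrite h2 // hT.
Qed.

Lemma ready_le B T env rho tt lr f f' s : f <= f' ->
  ready B T env rho tt lr f s -> ready B T env rho tt lr f' s.
Proof.
move=> le [[f0 hB hr he] [hl ht hs hT]]; split; split=> //; try lia.
by apply: sub_all hr => r; lia.
Qed.

Lemma ready_cons B T env rho tt lr f s r : r < f ->
  ready B T env rho tt lr f s -> ready B T (s.1 r :: env) (r :: rho) tt lr f s.
Proof. by move=> lt [[f0 hB hr he] [hl ht hs hT]]; split; split=> //=; rewrite ?lt ?he. Qed.

Lemma exec_copy x (a f : nat) (s : store) : a != f ->
  exists2 s', exec x (copy a f) s s' (3 * s.1 a + 2) &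
    frame f s s' /\ (forall r, s'.1 r = if r == f then s.1 a else s.1 r) /\ s'.2 = s.2.
Proof.
move=> naf.
have loop k (s1 : store) : s1.1 a = s1.1 f + k ->
    exists2 s', exec x (CUntil (TLe a f) (CInc f)) s1 s' (3 * k + 1) &
    (forall r, s'.1 r = if r == f then s1.1 a else s1.1 r) /\ s'.2 = s1.2.
  elim: k s1 => [|k IH] s1 h.
    exists s1; first by apply: ExDone; rewrite /= h addn0.
    by split=> // r; case: eqP => // ->; rewrite h addn0.
  have [|s' hs' [h1 h2]] := IH (upd s1.1 f (s1.1 f).+1, s1.2).
    by rewrite /upd /= (negbTE naf) eqxx h addnS addSn.
  have -> : 3 * k.+1 + 1 = 3 + (3 * k + 1) by lia.
  exists s'; first by apply: ExLoop (ExInc _ _ _) hs'; rewrite /= -ltnNge h; lia.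
  split=> // r; rewrite h1 /= /upd (negbTE naf); by case: eqP.
have [|s' hs' [h1 h2]] := loop (s.1 a) (upd s.1 f 0, s.2).
  by rewrite /upd /= (negbTE naf) eqxx.
have h1' r : s'.1 r = if r == f then s.1 a else s.1 r.
  by rewrite h1 /= /upd (negbTE naf); case: eqP.
exists s'; last split; [|split=> [r|t p] hr|by rewrite h2].
- have -> : 3 * s.1 a + 2 = 1 + (3 * s.1 a + 1) by lia.
  by apply: ExSeq (ExZero _ _ _) hs'.
- by rewrite h1'; case: eqP => //; lia.
- by rewrite h2.
Qed.

Lemma exec_clip x (f : nat) (s : store) : 0 < f ->
  exists s' n, [/\ exec x (clip f) s s' n, n <= 3 * s.1 0 + 4, frame f s s' &
                   s'.1 f = minn (s.1 f) (s.1 0)].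
Proof.
move=> f0; case: (leqP (s.1 f) (s.1 0)) => h.
  exists (upd s.1 f.+1 0, s.2), 3; split; [|lia|exact: frame_upd|].
    by apply: ExIfT => //; apply: ExZero.
  by rewrite /= /upd eqn_leq ltnn andbF.
have [|s' hs [hf [hr _]]] := @exec_copy x 0 f s; first by rewrite eq_sym -lt0n.
exists s', (3 * s.1 0 + 2).+1; split=> //; [|lia|by rewrite hr eqxx].
by apply: ExIfF; rewrite //= -ltnNge.
Qed.

(** Values grow only by [ESucc], so a result exceeds any common bound on [B] and the variables by an
    amount that depends on [B] alone. Iterating a loop body adds this amount once per round; a
    growth proportional to the variables would become exponential under iteration. *)
Fixpoint value_bound (e : expr) (B : nat) : nat :=
  match e with
  | EVar _ | EZero | EBound => 0
  | ESucc e => (value_bound e B).+1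
  | EIfLe _ _ e3 e4 => value_bound e3 B + value_bound e4 B
  | EFold _ e0 e1 => value_bound e0 B + B * value_bound e1 B
  | EIfInp _ _ e1 e2 | EIfTab _ e1 e2 => value_bound e1 B + value_bound e2 B
  | ELetTab _ _ e2 => value_bound e2 B
  | ELet e1 e2 => value_bound e1 B + value_bound e2 B
  | EDrop _ e => value_bound e B
  end.

Lemma iteri_bound (g : nat -> nat -> nat) a M c B i : a <= M ->
  (forall i a K, i < B -> a <= K -> M <= K -> g i a <= K + c) -> i <= B ->
  iteri i g a <= M + i * c.
Proof.
move=> ha hg; elim: i => [|i IH] hi /=; first by rewrite addn0.
by rewrite mulSn [c + _]addnC addnA; apply: hg (IH (ltnW hi)) _ => //; lia.
Qed.

Lemma eval_bound x B e T env M : B <= M -> all (fun a => a <= M) env ->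
  eval x B T env e <= M + value_bound e B.
Proof.
elim: e T env M => [i|||e IH|e1 _ e2 _ e3 IH3 e4 IH4|eN _ e0 IH0 e1 IH1|a e _ e1 IH1 e2 IH2
  |e _ e1 IH1 e2 IH2|eN _ e1 _ e2 IH2|e1 IH1 e2 IH2|k e IH] T env M hB hM /=.
- rewrite addn0; case: (ltnP i (size env)) => h; last by rewrite nth_default.
  exact: (allP hM) _ (mem_nth _ h).
- by [].
- by rewrite addn0.
- by rewrite addnS ltnS IH.
- by have := IH3 T env M hB hM; have := IH4 T env M hB hM; case: ifP; lia.
- rewrite addnA; apply: (leq_trans (iteri_bound (c := value_bound e1 B) (B := B)
    (IH0 _ _ _ hB hM) _ (geq_minr _ _))).
    move=> i b K hi hb hK; apply: IH1; rewrite /= ?hb; [lia|].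
    by rewrite andTb (leq_trans (ltnW hi)) /=; [apply: sub_all hM => d; lia|lia].
  by rewrite leq_add2l leq_mul2r geq_minr orbT.
- by have := IH1 T env M hB hM; have := IH2 T env M hB hM; case: ifP; lia.
- by have := IH1 T env M hB hM; have := IH2 T env M hB hM; case: ifP; lia.
- exact: IH2.
- rewrite addnA; apply: IH2; first lia.
  by rewrite /= IH1 //=; apply: sub_all hM => b; lia.
- by apply: IH => //; apply/allP => a /mem_drop /(allP hM).
Qed.

Fixpoint time_bound (e : expr) (B M : nat) : nat :=
  match e with
  | EVar _ | EBound => 3 * M + 2
  | EZero => 1
  | ESucc e => time_bound e B M + 1
  | EIfLe e1 e2 e3 e4 =>
      time_bound e1 B M + time_bound e2 B M + 2 + (time_bound e3 B M + time_bound e4 B M)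
  | EFold eN e0 e1 =>
      let M' := M + (value_bound e0 B + B * value_bound e1 B) in
      time_bound eN B M + (3 * B + 4) + time_bound e0 B M + 1 +
      (B * (time_bound e1 B M' + (3 * M' + 2) + 3) + 1) + (3 * M' + 2)
  | EIfInp _ e e1 e2 => time_bound e B M + 2 + (time_bound e1 B M + time_bound e2 B M)
  | EIfTab e e1 e2 => time_bound e B M + 4 + (time_bound e1 B M + time_bound e2 B M)
  | ELetTab eN e1 e2 =>
      time_bound eN B M + (3 * B + 4) + 1 + (B * (time_bound e1 B M + 7) + 1) +
      time_bound e2 B M + (3 * (M + value_bound e2 B) + 2)
  | ELet e1 e2 =>
      let M' := M + value_bound e1 B in
      time_bound e1 B M + time_bound e2 B M' + (3 * (M' + value_bound e2 B) + 2)
  | EDrop _ e => time_bound e B M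
  end.

Definition runs x c f s v b := exists s' n, [/\ exec x c s s' n, n <= b, frame f s s' & s'.1 f = v].

Lemma compile_exec x B e T env rho tt lr f s M :
  ready B T env rho tt lr f s -> B <= M -> all (fun a => a <= M) env ->
  runs x (compile e rho tt lr f) f s (eval x B T env e) (time_bound e B M).
Proof.
elim: e T env rho tt lr f s M => [i|||e IH|e1 IH1 e2 IH2 e3 IH3 e4 IH4|eN IHN e0 IH0 e1 IH1
  |a e IH e1 IH1 e2 IH2|e IH e1 IH1 e2 IH2|eN IHN e1 IH1 e2 IH2|e1 IH1 e2 IH2|k e IH]
  T env rho tt lr f s M hR hB hM /=.
- case: ifP => hi.
    have [[f0 _ hr he] _] := hR.
    have lt : nth 0 rho i < f by apply: (allP hr); apply: mem_nth.
    have [|s' hs [hf [hv _]]] := @exec_copy x (nth 0 rho i) f s; first by rewrite ltn_eqF.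
    have e0 : s.1 (nth 0 rho i) = nth 0 env i by rewrite -he (nth_map 0).
    exists s', (3 * s.1 (nth 0 rho i) + 2); split=> //; last by rewrite hv eqxx.
    suff : nth 0 env i <= M by lia.
    by apply: (allP hM); apply: mem_nth; rewrite -he size_map.
  exists (upd s.1 f 0, s.2), 1; split; [exact: ExZero|lia|exact: frame_upd|].
  rewrite /= /upd eqxx nth_default //; case: hR => [[_ _ _ <-] _].
  by rewrite size_map leqNgt hi.
- by exists (upd s.1 f 0, s.2), 1; split; [exact: ExZero| |exact: frame_upd|rewrite /= /upd eqxx].
- have [[f0 hB0 _ _] _] := hR.
  have [|s' hs [hf [hv _]]] := @exec_copy x 0 f s; first by rewrite ltn_eqF.
  exists s', (3 * s.1 0 + 2); split=> //; first by rewrite hB0; lia.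
  by rewrite hv eqxx hB0.
- have [s1 [n1 [x1 b1 f1 v1]]] := IH _ _ _ _ _ _ _ _ hR hB hM.
  exists (upd s1.1 f (s1.1 f).+1, s1.2), (n1 + 1); split; [|lia| |by rewrite /= /upd eqxx v1].
    exact: ExSeq x1 (ExInc _ _ _).
  exact: frame_trans f1 (frame_upd _ _ (leqnn f)).
- have [s1 [n1 [x1 b1 f1 v1]]] := IH1 _ _ _ _ _ _ _ _ hR hB hM.
  have R1 := ready_frame hR f1.
  have [s2 [n2 [x2 b2 f2 v2]]] := IH2 _ _ _ _ _ _ _ _ (ready_le (leqnSn f) R1) hB hM.
  have f2' := frame_le (leqnSn f) f2.
  have R2 := ready_frame R1 f2'.
  have v1' : s2.1 f = s1.1 f by case: f2 => h _; apply: h.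
  case: leqP => hle.
    have [s3 [n3 [x3 b3 f3 v3]]] := IH3 _ _ _ _ _ _ _ _ R2 hB hM.
    exists s3, (n1 + (n2 + n3.+2)); split=> //; [|lia|].
      by apply: ExSeq x1 (ExSeq x2 (ExIfT _ _ x3)); rewrite /= v1' v1 v2.
    exact: frame_trans f1 (frame_trans f2' f3).
  have [s3 [n3 [x3 b3 f3 v3]]] := IH4 _ _ _ _ _ _ _ _ R2 hB hM.
  exists s3, (n1 + (n2 + n3.+1)); split=> //; [|lia|].
    by apply: ExSeq x1 (ExSeq x2 (ExIfF _ _ x3)); rewrite /= v1' v1 v2 -ltnNge.
  exact: frame_trans f1 (frame_trans f2' f3).
- have f0 : 0 < f by case: hR => [[]].
  have [s1 [n1 [x1 b1 f1 v1]]] := IHN _ _ _ _ _ _ _ _ hR hB hM.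
  have R1 := ready_frame hR f1.
  have [s2 [n2 [x2 b2 f2 v2]]] := exec_clip x s1 f0.
  have R2 := ready_frame R1 f2.
  have B1 : s1.1 0 = B by case: R1 => [[]].
  rewrite B1 v1 in v2 b2; set N := minn _ _ in v2 *.
  have NB : N <= B by apply: geq_minr.
  have [s3 [n3 [x3 b3 f3 v3]]] := IH0 _ _ _ _ _ _ _ _ (ready_le (leqnSn f) R2) hB hM.
  pose s4 : store := (upd s3.1 f.+2 0, s3.2).
  have f34 : frame f.+2 s3 s4 by apply: frame_upd.
  have f24 : frame f.+1 s2 s4 by apply: frame_trans f3 (frame_le (leqnSn _) f34).
  pose A i := iteri i (fun i a => eval x B T [:: i, a & env] e1) (eval x B T env e0).
  set M' := M + _.
  have AM i : i <= B -> A i <= M'.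
    move=> hi; rewrite /M' addnA.
    apply: (leq_trans (iteri_bound (c := value_bound e1 B) (B := B) (eval_bound _ _ _ hB hM) _ hi)).
      move=> j b K hj hb hK; apply: eval_bound; rewrite /= ?hb; [lia|].
      by rewrite andTb (leq_trans (ltnW hj)) /=; [apply: sub_all hM => d; lia|lia].
    by rewrite leq_add2l leq_mul2r hi orbT.
  have MM' : M <= M' by apply: leq_addr.
  have hM' : all (fun a => a <= M') env by apply: sub_all hM => d; lia.
  set c := CUntil _ _; set b := _ + (3 * M' + 2) + 3.
  (* [k] counts the rounds left. Registers [f.+1] and [f.+2] hold the accumulator and the round
     number, and the frame at [f.+1] preserves the limit [N] in register [f]. *)
  have loop k : forall i (s5 : store), i + k = N -> frame f.+1 s2 s5 ->
      s5.1 f.+1 = A i -> s5.1 f.+2 = i ->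
      exists s6 n, [/\ exec x c s5 s6 n, n <= k * b + 1, frame f.+1 s2 s6 & s6.1 f.+1 = A N].
    elim: k => [|k IH] i s5 hik f5 a5 i5.
      exists s5, 1; split=> //; last by rewrite a5 -hik addn0.
      by apply: ExDone; rewrite /= (proj1 f5) // v2 i5 -hik addn0.
    have R5 := ready_le (leq_addl 3 f) (ready_frame R2 (frame_le (leqnSn f) f5)).
    have f3f : f.+1 < 3 + f by lia.
    have f4f : f.+2 < 3 + f by lia.
    have := ready_cons f4f (ready_cons f3f R5); rewrite a5 i5 => R5'.
    have [||s6 [n6 [x6 b6 f6 v6]]] := IH1 _ _ _ _ _ _ _ M' R5'; [lia| |].
      by rewrite /= AM; last lia; rewrite hM' !andbT; lia.
    have [|s7 x7 [f7 [v7 t7]]] := @exec_copy x f.+3 f.+1 s6; first by lia.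
    pose s8 : store := (upd s7.1 f.+2 (s7.1 f.+2).+1, s7.2).
    have f8 : frame f.+1 s2 s8.
      apply: (frame_trans f5); apply: (frame_trans (frame_le _ f6)); first lia.
      by apply: (frame_trans f7); apply: frame_upd.
    have [|||s9 [n9 [x9 b9 f9 v9]]] := IH i.+1 s8 _ f8; first lia.
    - by rewrite /= /upd ltn_eqF // v7 eqxx v6.
    - by rewrite /= /upd eqxx v7 gtn_eqF // (proj1 f6) ?i5.
    exists s9, ((n6 + ((3 * s6.1 f.+3 + 2) + 1)).+2 + n9); split=> //.
      apply: ExLoop (ExSeq x6 (ExSeq x7 (ExInc _ _ _))) x9.
      by rewrite /= (proj1 f5) // v2 i5; lia.
    have a6 : s6.1 f.+3 <= M' by rewrite v6; apply: (AM i.+1); lia.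
    by rewrite mulSn /b; lia.
  have [|||s6 [n6 [x6 b6 f6 v6]]] := loop N 0 s4 _ f24; first by rewrite add0n.
  - by rewrite (proj1 f34) // v3.
  - by rewrite /= /upd eqxx.
  have [|s7 x7 [f7 [v7 t7]]] := @exec_copy x f.+1 f s6; first by lia.
  exists s7, (n1 + (n2 + (n3 + (1 + (n6 + (3 * s6.1 f.+1 + 2)))))); split.
  - by apply: ExSeq x1 (ExSeq x2 (ExSeq x3 (ExSeq (ExZero _ _ _) (ExSeq x6 x7)))).
  - have aN : s6.1 f.+1 <= M' by rewrite v6 AM.
    have : N * b <= B * b by rewrite leq_mul2r NB orbT.
    by rewrite /b; lia.
  - apply: (frame_trans f1); apply: (frame_trans f2).
    by apply: (frame_trans (frame_le (leqnSn f) f6)).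
  - by rewrite v7 eqxx.
- have [s1 [n1 [x1 b1 f1 v1]]] := IH _ _ _ _ _ _ _ _ hR hB hM.
  have R1 := ready_frame hR f1.
  case: ifP => hle.
    have [s3 [n3 [x3 b3 f3 v3]]] := IH1 _ _ _ _ _ _ _ _ R1 hB hM.
    exists s3, (n1 + n3.+2); split=> //; [|lia|exact: frame_trans f1 f3].
    by apply: ExSeq x1 (ExIfT _ _ x3); rewrite /= v1.
  have [s3 [n3 [x3 b3 f3 v3]]] := IH2 _ _ _ _ _ _ _ _ R1 hB hM.
  exists s3, (n1 + n3.+1); split=> //; [|lia|exact: frame_trans f1 f3].
  by apply: ExSeq x1 (ExIfF _ _ x3); rewrite /= v1 hle.
- have [s1 [n1 [x1 b1 f1 v1]]] := IH _ _ _ _ _ _ _ _ hR hB hM.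
  have R1 := ready_frame hR f1.
  have [_ [_ _ hs hT]] := R1.
  have [s2 [n2 [x2 b2 f2 v2]]] := IH2 _ _ _ _ _ _ _ _ R1 hB hM.
  case: (leqP (size T) (eval x B T env e)) => hsz.
    rewrite nth_default //.
    exists s2, (n1 + n2.+2); split=> //; [|lia|exact: frame_trans f1 f2].
    by apply: ExSeq x1 (ExIfT _ _ x2); rewrite /= v1 hs.
  case: ifP => hle.
    have [s3 [n3 [x3 b3 f3 v3]]] := IH1 _ _ _ _ _ _ _ _ R1 hB hM.
    exists s3, (n1 + n3.+2.+1); split=> //; [|lia|exact: frame_trans f1 f3].
    apply: ExSeq x1 (ExIfF _ _ (ExIfT _ _ x3)); first by rewrite /= v1 hs -ltnNge.
    by rewrite /= v1 hT.
  exists s2, (n1 + n2.+1.+1); split=> //; [|lia|exact: frame_trans f1 f2].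
  apply: ExSeq x1 (ExIfF _ _ (ExIfF _ _ x2)); first by rewrite /= v1 hs -ltnNge.
  by rewrite /= v1 hT // hle.
- have f0 : 0 < f by case: hR => [[]].
  have [s1 [n1 [x1 b1 f1 v1]]] := IHN _ _ _ _ _ _ _ _ hR hB hM.
  have R1 := ready_frame hR f1.
  have [s2 [n2 [x2 b2 f2 v2]]] := exec_clip x s1 f0.
  have R2 := ready_frame R1 f2.
  have B1 : s1.1 0 = B by case: R1 => [[]].
  rewrite B1 v1 in v2 b2; set N := minn _ _ in v2 *.
  have NB : N <= B by apply: geq_minr.
  pose A i := iteri i (fun i T' => rcons T' (0 < eval x B T' (i :: env) e1)) [::].
  have sA i : size (A i) = i by elim: i => //= i IH; rewrite size_rcons IH.
  rewrite -/(A N).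
  pose s4 : store := (upd s2.1 f.+1 0, s2.2).
  have f24 : frame f.+1 s2 s4 by apply: frame_upd.
  (* The round counter in [f.+1] doubles as the length of the table under construction, so the body
     is run against exactly the entries computed so far. *)
  have R4 i (s5 : store) : frame f s2 s5 -> s5.1 f.+1 = i ->
      (forall j, j < i -> s5.2 f j = nth false (A i) j) ->
      ready B (A i) env rho f f.+1 f.+2 s5.
    move=> f5 i5 t5; have [[_ hB5 hr5 he5] _] := ready_le (leq_addl 2 f) (ready_frame R2 f5).
    by split; split=> //; rewrite ?sA.
  set c := CUntil _ _; set b := time_bound e1 B M + 7.
  have loop k : forall i (s5 : store), i + k = N -> frame f s2 s5 -> s5.1 f = N ->
      s5.1 f.+1 = i -> (forall j, j < i -> s5.2 f j = nth false (A i) j) ->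
      exists s6 n, [/\ exec x c s5 s6 n, n <= k * b + 1, frame f s2 s6 &
        s6.1 f.+1 = N /\ (forall j, j < N -> s6.2 f j = nth false (A N) j)].
    elim: k => [|k IH] i s5 hik f5 N5 i5 t5.
      have -> : N = i by rewrite -hik addn0.
      exists s5, 1; split=> //; apply: ExDone; rewrite /= N5 i5 -hik addn0 //.
    have R5 := R4 i s5 f5 i5 t5.
    have f3f : f.+1 < f.+2 by lia.
    have := ready_cons f3f R5; rewrite i5 => R5'.
    have [||s6 [n6 [x6 b6 f6 v6]]] := IH1 _ _ _ _ _ _ _ M R5'; [lia| |].
      by rewrite /= hM andbT; lia.
    pose s7 : store := (upd s6.1 f.+3 0, s6.2).
    pose v := 0 < eval x B (A i) (i :: env) e1.
    pose s8 : store := (s7.1, upd s7.2 f (upd (s7.2 f) (s7.1 f.+1) v)).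
    pose s9 : store := (upd s8.1 f.+1 (s8.1 f.+1).+1, s8.2).
    have i7 : s7.1 f.+1 = i by rewrite /= /upd ltn_eqF // (proj1 f6) // i5.
    have x8 : exists2 n8, n8 <= 3 &
        exec x (CIf (TLe f.+2 f.+3) (CSet f f.+1 false) (CSet f f.+1 true)) s7 s8 n8.
      have e7 : (s7.1 f.+2 <= s7.1 f.+3) = ~~ v.
        by rewrite /= /upd eqxx ltn_eqF // v6 /v -leqNgt.
      case: (boolP v) e7 => hv e7.
        exists 2 => //; have -> : s8 = (s7.1, upd s7.2 f (upd (s7.2 f) (s7.1 f.+1) true)).
          by rewrite /s8 hv.
        by apply: ExIfF; [rewrite /= e7|exact: ExSet].
      exists 3 => //; have -> : s8 = (s7.1, upd s7.2 f (upd (s7.2 f) (s7.1 f.+1) false)).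
        by rewrite /s8 (negbTE hv).
      by apply: ExIfT; [rewrite /= e7|exact: ExSet].
    have [n8 b8 {}x8] := x8.
    have f57 : frame f.+2 s5 s7 by apply: (frame_trans f6); apply: frame_upd.
    have f9 : frame f s2 s9.
      apply: (frame_trans f5); apply: (frame_trans (frame_le _ f57)); first lia.
      split=> [r|t p] hr /=; rewrite /upd; first by rewrite ltn_eqF //; lia.
      by rewrite ltn_eqF.
    have [|||j|s10 [n10 [x10 b10 f10 v10]]] := IH i.+1 s9 _ f9; first lia.
    - have -> : s9.1 f = s7.1 f by rewrite {1}/s9 /= {1}/upd ltn_eqF.
      by rewrite (proj1 f57).
    - have -> : s9.1 f.+1 = (s7.1 f.+1).+1 by rewrite {1}/s9 /= {1}/upd eqxx.
      by rewrite i7.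
    - rewrite ltnS => hj; have -> : s9.2 f j = upd (s7.2 f) i v j.
        by rewrite -i7 /= {1}/upd eqxx.
      rewrite /upd nth_rcons sA.
      case: eqP => [->|nj]; first by rewrite ltnn.
      have lj : j < i by lia.
      by rewrite lj (proj2 f57) // t5.
    exists s10, ((n6 + (1 + (n8 + 1))).+2 + n10); split=> //.
      apply: ExLoop (ExSeq x6 (ExSeq (ExZero _ _ _) (ExSeq x8 (ExInc _ _ _)))) x10.
      by rewrite /= N5 i5; lia.
    by rewrite mulSn /b; lia.
  have [||||s6 [n6 [x6 b6 f6 [v6 t6]]]] := loop N 0 s4 _ (frame_le (leqnSn f) f24).
  - by rewrite add0n.
  - by rewrite (proj1 f24).
  - by rewrite /= /upd eqxx.
  - by [].
  have R6 := R4 N s6 f6 v6 t6.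
  have [s7 [n7 [x7 b7 f7 v7]]] := IH2 _ _ _ _ _ _ _ _ R6 hB hM.
  have [|s8 x8 [f8 [v8 t8]]] := @exec_copy x f.+2 f s7; first by lia.
  exists s8, (n1 + (n2 + (1 + (n6 + (n7 + (3 * s7.1 f.+2 + 2)))))); split.
  - by apply: ExSeq x1 (ExSeq x2 (ExSeq (ExZero _ _ _) (ExSeq x6 (ExSeq x7 x8)))).
  - have aN : s7.1 f.+2 <= M + value_bound e2 B by rewrite v7 eval_bound.
    have : N * b <= B * b by rewrite leq_mul2r NB orbT.
    by rewrite /b; lia.
  - apply: (frame_trans f1); apply: (frame_trans f2); apply: (frame_trans f6).
    by apply: (frame_trans (frame_le _ f7)); first lia.
  - by rewrite v8 eqxx.
- have [s1 [n1 [x1 b1 f1 v1]]] := IH1 _ _ _ _ _ _ _ _ hR hB hM.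
  have := ready_cons (leqnn f.+1) (ready_le (leqnSn f) (ready_frame hR f1)).
  rewrite v1 => R1.
  have [||s2 [n2 [x2 b2 f2 v2]]] := IH2 _ _ _ _ _ _ _ (M + value_bound e1 B) R1; first lia.
    by rewrite /= eval_bound //=; apply: sub_all hM => d; lia.
  have [|s3 x3 [f3 [v3 t3]]] := @exec_copy x f.+1 f s2; first by lia.
  exists s3, (n1 + (n2 + (3 * s2.1 f.+1 + 2))); split.
  - by apply: ExSeq x1 (ExSeq x2 x3).
  - suff : s2.1 f.+1 <= M + value_bound e1 B + value_bound e2 B by lia.
    rewrite v2 eval_bound //=; first lia.
    by rewrite eval_bound //=; apply: sub_all hM => d; lia.
  - by apply: (frame_trans f1); apply: (frame_trans (frame_le (leqnSn f) f2)).
  - by rewrite v3 eqxx.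
- apply: IH => //; last by apply/allP => d /mem_drop /(allP hM).
  have [[f0 hB0 hr he] hT] := hR; split=> //; split=> //; last by rewrite map_drop he.
  by apply/allP => d /mem_drop /(allP hr).
Qed.

(** * Polynomial running time *)

(** The base is at least 2 whatever [B] and [M] are, so constants lie below a power and the sum of
    two powers is absorbed by a larger exponent. *)
Definition poly_bounded (f : nat -> nat -> nat) :=
  exists k, forall B M, f B M <= (B + M + 2) ^ k.

Lemma leq_expl m n e : m <= n -> m ^ e <= n ^ e.
Proof. by case: e => // e h; rewrite leq_exp2r. Qed.

Lemma pb_le f g : (forall B M, f B M <= g B M) -> poly_bounded g -> poly_bounded f.
Proof. by move=> le [k hk]; exists k => B M; apply: leq_trans (le B M) (hk B M). Qed.

Lemma pb_const c : poly_bounded (fun _ _ => c).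
Proof.
exists c => B M; apply: ltnW; apply: (leq_trans (ltn_expl c (leqnn 2))).
by apply: leq_expl; lia.
Qed.

Lemma pb_fst : poly_bounded (fun B _ => B).
Proof. by exists 1 => B M; rewrite expn1; lia. Qed.

Lemma pb_snd : poly_bounded (fun _ M => M).
Proof. by exists 1 => B M; rewrite expn1; lia. Qed.

Lemma pb_add f g : poly_bounded f -> poly_bounded g ->
  poly_bounded (fun B M => f B M + g B M).
Proof.
move=> [a ha] [b hb]; exists (a + b).+1 => B M.
have X2 : 1 < B + M + 2 by lia.
have h1 : (B + M + 2) ^ a <= (B + M + 2) ^ (a + b) by rewrite leq_exp2l // leq_addr.
have h2 : (B + M + 2) ^ b <= (B + M + 2) ^ (a + b) by rewrite leq_exp2l // leq_addl.
have := ha B M; have := hb B M; rewrite expnS.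
have : 2 * (B + M + 2) ^ (a + b) <= (B + M + 2) * (B + M + 2) ^ (a + b).
  by rewrite leq_mul2r X2 orbT.
by lia.
Qed.

Lemma pb_mul f g : poly_bounded f -> poly_bounded g ->
  poly_bounded (fun B M => f B M * g B M).
Proof.
by move=> [a ha] [b hb]; exists (a + b) => B M; rewrite expnD leq_mul.
Qed.

(** Loop bodies are charged at an enlarged bound on the variables. That bound is itself polynomial,
    and it is substituted only as often as the fixed expression nests. *)
Lemma pb_comp f g : poly_bounded f -> poly_bounded g ->
  poly_bounded (fun B M => f B (g B M)).
Proof.
move=> [b hb] hg; have [c hc] := pb_add (pb_add pb_fst (pb_const 2)) hg.
exists (c * b) => B M; apply: leq_trans (hb _ _) _.
by rewrite expnM; apply: leq_expl; have := hc B M; lia.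
Qed.

Lemma pb_value_bound e : poly_bounded (fun B _ => value_bound e B).
Proof.
elim: e => [i|||e IH|e1 _ e2 _ e3 IH3 e4 IH4|eN _ e0 IH0 e1 IH1|a e _ e1 IH1 e2 IH2
  |e _ e1 IH1 e2 IH2|eN _ e1 _ e2 IH2|e1 IH1 e2 IH2|k e IH] /=;
  try by do ![exact: pb_const|exact: pb_fst|assumption|apply: pb_add|apply: pb_mul].
apply: (@pb_le _ (fun B _ => value_bound e B + 1)) => [B M|]; first by rewrite addn1.
exact: pb_add IH (pb_const 1).
Qed.

Lemma pb_time_bound e : poly_bounded (time_bound e).
Proof.
have pv := pb_value_bound.
elim: e => [i|||e IH|e1 IH1 e2 IH2 e3 IH3 e4 IH4|eN IHN e0 IH0 e1 IH1
  |a e IH e1 IH1 e2 IH2|e IH e1 IH1 e2 IH2|eN IHN e1 IH1 e2 IH2|e1 IH1 e2 IH2|k e IH] /=;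
  do ![exact: pb_const|exact: pb_fst|exact: pb_snd|exact: pv|assumption
      |apply: pb_add|apply: pb_mul|apply: (pb_comp IH1)|apply: (pb_comp IH2)].
Qed.

(** Register 0 runs through the values of [B], register 1 stays 0 as the length of an empty table,
    and register 3 receives the result. Register 2 is the threshold, 1 during the search and 2 for
    the verdict; the last test turns a result of at least 2 into 0, the accepting value. *)
Definition search (e : expr) : cmd :=
  let body := compile e [::] 0 1 3 in
  CInc 2;; body;; CUntil (TLe 2 3) (CInc 0;; body);;
  CInc 2;; CIf (TLe 2 3) (CZero 3) (CZero 3;; CInc 3).

Lemma search_exec x e b : 0 < eval x b [::] [::] e ->
  (forall B, B < b -> eval x B [::] [::] e = 0) ->
  forall K, (forall B, B <= b -> time_bound e B B <= K) ->
  exists s' n, [/\ exec x (search e) (fun=> 0, fun _ _ => false) s' n,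
    n <= b.+1 * (K + 3) + 7 & s'.1 3 = 0 <-> 1 < eval x b [::] [::] e].
Proof.
move=> hb hlt K hK; pose v B := eval x B [::] [::] e.
pose inv B (s : store) := [/\ s.1 0 = B, s.1 1 = 0 & s.1 2 = 1].
have body B (s : store) : B <= b -> inv B s ->
    exists s' n, [/\ exec x (compile e [::] 0 1 3) s s' n, n <= K, inv B s' & s'.1 3 = v B].
  move=> hB [s0 s1 s2].
  have R : ready B [::] [::] [::] 0 1 3 s by split; split.
  have [|s' [n [x1 b1 f1 v1]]] := compile_exec x e R (leqnn B); first by [].
  exists s', n; split=> //; first exact: leq_trans b1 (hK _ hB).
  by split; rewrite (proj1 f1).
have loop k : forall B (s : store), B + k = b -> inv B s -> s.1 3 = v B ->
    exists s' n, [/\ exec x (CUntil (TLe 2 3) (CInc 0;; compile e [::] 0 1 3)) s s' n,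
      n <= k * (K + 3) + 1, inv b s' & s'.1 3 = v b].
  elim: k => [|k IH] B s hBk [s0 s1 s2] s3.
    rewrite addn0 in hBk; rewrite hBk in s0 s3.
    by exists s, 1; split=> //; apply: ExDone; rewrite /= s2 s3.
  pose s' : store := (upd s.1 0 (s.1 0).+1, s.2).
  have [||s4 [n4 [x4 b4 i4 v4]]] := body B.+1 s'; first lia.
    by split=> //=; rewrite /upd /= s0.
  have [|s5 [n5 [x5 b5 i5 v5]]] := IH B.+1 s4 _ i4 v4; first lia.
  exists s5, ((1 + n4).+2 + n5); split=> //; last by rewrite mulSn; lia.
  apply: ExLoop (ExSeq (ExInc _ _ _) x4) x5.
  by rewrite /= s2 s3 /v hlt //; lia.
pose s1 : store := (upd (fun=> 0) 2 1, fun _ _ => false).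
have [||s2 [n2 [x2 b2 i2 v2]]] := body 0 s1 => //.
have [s3 [n3 [x3 b3 i3 v3]]] := loop b 0 s2 (add0n b) i2 v2.
pose s4 : store := (upd s3.1 2 (s3.1 2).+1, s3.2).
have e4 : teval x s4 (TLe 2 3) = (1 < v b).
  by rewrite /= /upd /= v3; case: i3 => _ _ ->.
have tail c s5 n5 : exec x c s4 s5 n5 ->
    exec x (CInc 2;; compile e [::] 0 1 3;;
      CUntil (TLe 2 3) (CInc 0;; compile e [::] 0 1 3);; CInc 2;; c)
      (fun=> 0, fun _ _ => false) s5 (1 + (n2 + (n3 + (1 + n5)))).
  move=> x5; apply: (ExSeq (ExInc x 2 (fun=> 0, fun _ _ => false))
    (ExSeq x2 (ExSeq x3 (ExSeq (ExInc x 2 s3) x5)))).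
case: (boolP (1 < v b)) e4 => hv e4.
  exists (upd s4.1 3 0, s4.2), (1 + (n2 + (n3 + (1 + 3)))); split.
  - by apply: tail; apply: ExIfT => //; apply: ExZero.
  - by rewrite mulSn; lia.
  - by [].
pose s5 : store := (upd s4.1 3 0, s4.2).
exists (upd s5.1 3 (s5.1 3).+1, s5.2), (1 + (n2 + (n3 + (1 + 3)))); split.
- apply: tail; apply: ExIfF; first by rewrite e4.
  exact: (ExSeq (ExZero _ _ s4) (ExInc _ _ s5)).
- by rewrite mulSn; lia.
- by split=> // h; rewrite /v h in hv.
Qed.

Lemma decides_within_iff M x t P Q : (P <-> Q) ->
  decides_within M x t P -> decides_within M x t Q.
Proof. by rewrite /decides_within; case: (iter _ _ _) => [[q l] r] PQ [h1 h2]; split; tauto. Qed.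

(** Only the analysis knows [b]. The machine stops at the least [B] with a positive value, which is
    at most [b]; so [b] bounds the time, while the verdict is the one given at [B]. *)
Theorem expr_TM (e : expr) : exists (M : TM) (c : nat), tm_wf M /\
  forall x b, 0 < eval x b [::] [::] e ->
  exists t B, [/\ t <= (b + 2) ^ c, 0 < eval x B [::] [::] e &
    decides_within M x t (1 < eval x B [::] [::] e)].
Proof.
have [k hk] := pb_time_bound e.
have [M wfM hM] := cmd_TM (search e) 3.
pose N b := b.+1 * ((b + b + 2) ^ k + 3) + 7.
have [c hc] : poly_bounded (fun b _ => N b * (N b).*2.+3 + 2).
  have pN : poly_bounded (fun b _ => N b).
    apply: pb_add (pb_const 7); apply: pb_mul.
      by apply: (pb_le _ (pb_add pb_fst (pb_const 1))) => B M'; rewrite addn1.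
    apply: pb_add (pb_const 3).
    exists (k.*2) => B M'; rewrite -mul2n expnM; apply: leq_expl.
    by rewrite expnS expn1; nia.
  apply: pb_add (pb_const 2); apply: (pb_mul pN).
  apply: (pb_le _ (pb_add (pb_mul (pb_const 2) pN) (pb_const 3))) => B M'; lia.
exists M, c; split=> // x b hb.
have ex : exists B, 0 < eval x B [::] [::] e by exists b.
case: (ex_minnP ex) => B hB hmin.
have Bb : B <= b by apply: hmin.
have [|B' hB'|s' [n [x1 b1 hs]]] := search_exec hB _ (K := (b + b + 2) ^ k).
- by move=> B' lt; apply/eqP; rewrite -leqn0 leqNgt; apply/negP => /hmin; lia.
- by apply: leq_trans (hk _ _) _; apply: leq_expl; lia.
have [t ht hd] := hM _ _ _ x1.
exists t, B; split=> //; last exact: decides_within_iff hd.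
apply: leq_trans ht _; apply: leq_trans (_ : N b * (N b).*2.+3 + 2 <= _).
  have nN : n <= N b.
    apply: leq_trans b1 _; rewrite /N leq_add2r leq_mul2r ltnS Bb; lia.
  by rewrite leq_add2r; apply: leq_mul => //; lia.
by have := hc b 0; rewrite addn0.
Qed.

(** * Computable functions and bounded arithmetic *)

(** Programs are written below as ordinary functions of the input, the bound, the table and the
    variables. Closure lemmas then supply an expression for each of them, so no expression is
    handled by hand. *)
Definition computable (F : seq sym -> nat -> seq bool -> seq nat -> nat) :=
  exists e, forall x B T s, eval x B T s e = F x B T s.

Definition computableb (P : seq sym -> nat -> seq bool -> seq nat -> bool) :=
  exists e, forall x B T s, eval x B T s e = P x B T s.

(** A loop body sees its own index and accumulator in front of the outer variables. Outer functions
    are therefore evaluated in a suffix of the current environment, and this names the projections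
    that occur. *)
Definition shift (p : seq nat -> seq nat) := exists k, forall s, p s = drop k s.

(* Loops are cut at [B]: what is defined from them below agrees with the usual
   arithmetic only as long as the values stay below [B]. *)
Definition loop (A : Type) (B n : nat) (f : nat -> A -> A) (a : A) := iteri (minn n B) f a.
Definition existsB (B n : nat) (P : pred nat) := has P (iota 0 (minn n B)).
Definition forallB (B n : nat) (P : pred nat) := all P (iota 0 (minn n B)).

Lemma shift_id : shift (fun s => s).
Proof. by exists 0 => s; rewrite drop0. Qed.

Lemma shift_drop k p : shift p -> shift (fun s => drop k (p s)).
Proof. by move=> [j hj]; exists (k + j) => s; rewrite hj drop_drop. Qed.

Lemma comp_shift F p : computable F -> shift p -> computable (fun x B T s => F x B T (p s)).
Proof. by move=> [e he] [k hk]; exists (EDrop k e) => x B T s; rewrite /= he hk. Qed.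

Lemma compb_shift P p : computableb P -> shift p -> computableb (fun x B T s => P x B T (p s)).
Proof. by move=> [e he] [k hk]; exists (EDrop k e) => x B T s; rewrite /= he hk. Qed.

(* Binds a value, so that a later change of the table does not affect it. *)
Lemma compb_let F P : computable F -> computableb P ->
  computableb (fun x B T s => P x B T (F x B T s :: s)).
Proof. by move=> [f hf] [e he]; exists (ELet f e) => x B T s; rewrite /= he hf. Qed.

Lemma comp_var p i : shift p -> computable (fun x B T s => nth 0 (p s) i).
Proof. by move=> [k hk]; exists (EDrop k (EVar i)) => x B T s; rewrite /= hk. Qed.

Lemma comp_bound : computable (fun x B T s => B).
Proof. by exists EBound. Qed.

Lemma comp_zero : computable (fun x B T s => 0).
Proof. by exists EZero. Qed.

Lemma comp_succ F : computable F -> computable (fun x B T s => (F x B T s).+1).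
Proof. by move=> [e he]; exists (ESucc e) => x B T s; rewrite /= he. Qed.

Lemma comp_const c : computable (fun x B T s => c).
Proof. by elim: c => [|c IH]; [exact: comp_zero|exact: comp_succ]. Qed.

Lemma comp_ext F G : (forall x B T s, F x B T s = G x B T s) -> computable F -> computable G.
Proof. by move=> FG [e he]; exists e => x B T s; rewrite he FG. Qed.

Lemma compb_comp P : computable (fun x B T s => nat_of_bool (P x B T s)) -> computableb P.
Proof. by []. Qed.

Lemma comp_nat P : computableb P -> computable (fun x B T s => nat_of_bool (P x B T s)).
Proof. by []. Qed.

Lemma comp_if P F G : computableb P -> computable F -> computable G ->
  computable (fun x B T s => if P x B T s then F x B T s else G x B T s).
Proof.
move=> [p hp] [f hf] [g hg]; exists (EIfLe (ESucc EZero) p f g) => x B T s.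
by rewrite /= hp hf hg; case: (P x B T s).
Qed.

Lemma compb_if P F G : computableb P -> computableb F -> computableb G ->
  computableb (fun x B T s => if P x B T s then F x B T s else G x B T s).
Proof.
move=> hp hf hg; apply: compb_comp; apply: comp_ext (comp_if hp hf hg) => x B T s.
by case: (P x B T s).
Qed.

Lemma compb_const b : computableb (fun x B T s => b).
Proof. exact: (comp_const b). Qed.

Lemma compb_leq F G : computable F -> computable G ->
  computableb (fun x B T s => F x B T s <= G x B T s).
Proof.
move=> [f hf] [g hg]; exists (EIfLe f g (ESucc EZero) EZero) => x B T s.
by rewrite /= hf hg; case: leqP.
Qed.

Lemma compb_and P Q : computableb P -> computableb Q ->
  computableb (fun x B T s => P x B T s && Q x B T s).
Proof. by move=> p q; apply: compb_if => //; apply: compb_const. Qed.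

Lemma compb_or P Q : computableb P -> computableb Q ->
  computableb (fun x B T s => P x B T s || Q x B T s).
Proof. by move=> p q; apply: compb_if => //; apply: compb_const. Qed.

Lemma compb_imply P Q : computableb P -> computableb Q ->
  computableb (fun x B T s => P x B T s ==> Q x B T s).
Proof. by move=> p q; apply: compb_if => //; apply: compb_const. Qed.

Lemma compb_neg P : computableb P -> computableb (fun x B T s => ~~ P x B T s).
Proof. by move=> p; apply: compb_if => //; apply: compb_const. Qed.

Lemma compb_eq F G : computable F -> computable G ->
  computableb (fun x B T s => F x B T s == G x B T s).
Proof.
move=> f g; have [e he] := compb_and (compb_leq f g) (compb_leq g f).
by exists e => x B T s; rewrite he eqn_leq.
Qed.

Lemma comp_input F : computable F -> computable (fun x B T s => input x (F x B T s)).
Proof.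
move=> [f hf]; pose c n := iter n ESucc EZero.
exists (EIfInp 0 f (c 0) (EIfInp 1 f (c 1) (EIfInp 2 f (c 2) (EIfInp 3 f (c 3) (c 4))))).
move=> x B T s; rewrite /= hf.
by have := input_lt5 x (F x B T s); case: (input _ _) => [|[|[|[|[|]]]]].
Qed.

Lemma compb_table F : computable F -> computableb (fun x B T s => nth false T (F x B T s)).
Proof.
move=> [f hf]; exists (EIfTab f (ESucc EZero) EZero) => x B T s.
by rewrite /= hf; case: nth.
Qed.

Lemma comp_loop FN F0 F1 : computable FN -> computable F0 ->
  computable (fun x B T s => F1 x B T (nth 0 s 0) (nth 0 s 1) (drop 2 s)) ->
  computable (fun x B T s => loop B (FN x B T s) (fun i a => F1 x B T i a s) (F0 x B T s)).
Proof.
move=> [n hn] [f hf] [g hg]; exists (EFold n f g) => x B T s.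
rewrite /loop /= hn hf; elim: (minn _ _) => //= k ->.
by rewrite hg /= drop0.
Qed.

Lemma compb_exists FN P : computable FN ->
  computableb (fun x B T s => P x B T (nth 0 s 0) (drop 2 s)) ->
  computableb (fun x B T s => existsB B (FN x B T s) (fun i => P x B T i s)).
Proof.
move=> hn hP; apply: compb_comp.
have := @comp_loop FN (fun _ _ _ _ => 0)
  (fun x B T i a s => if P x B T i s then 1 else a) hn comp_zero.
case; first by apply: comp_if => //; [exact: (comp_const 1)|exact: (comp_var 1 shift_id)].
move=> e he; exists e => x B T s; rewrite he /loop /existsB.
elim: (minn _ _) => // k IH.
by rewrite -[in iota _ _]addn1 iotaD has_cat /= orbF IH; case: ifP; rewrite ?orbT ?orbF.
Qed.

Lemma compb_forall FN P : computable FN ->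
  computableb (fun x B T s => P x B T (nth 0 s 0) (drop 2 s)) ->
  computableb (fun x B T s => forallB B (FN x B T s) (fun i => P x B T i s)).
Proof.
move=> hn hP; have [e he] := compb_neg
  (compb_exists (P := fun x B T i s => ~~ P x B T i s) hn (compb_neg hP)).
exists e => x B T s; rewrite he /existsB /forallB -all_predC.
by congr nat_of_bool; apply: eq_all => i /=; rewrite negbK.
Qed.

Definition table (B n : nat) (f : nat -> seq bool -> bool) : seq bool :=
  loop B n (fun i T => rcons T (f i T)) [::].

Lemma compb_lettab FN P Q : computable FN ->
  computableb (fun x B T s => P x B T (nth 0 s 0) (drop 1 s)) -> computableb Q ->
  computableb (fun x B T s => Q x B (table B (FN x B T s) (fun i T' => P x B T' i s)) s).
Proof.
move=> [n hn] [p hp] [q hq]; exists (ELetTab n p q) => x B T s.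
rewrite /= hq hn /table /loop; congr (nat_of_bool (Q _ _ _ _)).
by elim: (minn _ _) => //= k ->; rewrite hp /= drop0 lt0b.
Qed.

Create HintDb computable discriminated.
#[local] Hint Constants Opaque : computable.
#[local] Hint Variables Opaque : computable.
#[local] Hint Resolve shift_id shift_drop comp_bound comp_const
  comp_succ comp_nat comp_if compb_if compb_const compb_leq compb_and compb_or compb_imply
  compb_neg compb_eq comp_input compb_table comp_loop compb_exists compb_forall : computable.
#[local] Hint Extern 0 (shift _) => refine (shift_drop _ _) : computable.
#[local] Hint Extern 0 (computable _) => refine (comp_var _ _) : computable.
#[local] Hint Extern 0 (computable _) =>
  match goal with H : computable _ |- _ => refine (comp_shift H _) end : computable.
#[local] Hint Extern 0 (computableb _) =>
  match goal with H : computableb _ |- _ => refine (compb_shift H _) end : computable.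

Ltac comp_tac := intros; solve [auto 100 with nocore computable].

(** * Arithmetic capped at [B] *)

Definition addB (B a b : nat) := loop B b (fun _ c => c.+1) a.

Lemma comp_add F G : computable F -> computable G ->
  computable (fun x B T s => addB B (F x B T s) (G x B T s)).
Proof. by rewrite /addB; comp_tac. Qed.

Lemma addBE B a b : addB B a b = a + minn b B.
Proof. by rewrite /addB /loop; elim: (minn b B) => [|k /= ->]; rewrite ?addn0 ?addnS. Qed.

Definition sumB (B n : nat) (f : nat -> nat) := loop B n (fun i a => addB B a (f i)) 0.
#[local] Hint Resolve comp_add : computable.

Lemma comp_sum FN F : computable FN ->
  computable (fun x B T s => F x B T (nth 0 s 0) (drop 2 s)) ->
  computable (fun x B T s => sumB B (FN x B T s) (fun i => F x B T i s)).
Proof. by rewrite /sumB; comp_tac. Qed.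
#[local] Hint Resolve comp_sum : computable.

Lemma sumBE B n f : n <= B -> (forall i, i < n -> f i <= B) ->
  sumB B n f = \sum_(0 <= i < n) f i.
Proof.
move=> nB hf; rewrite /sumB /loop (minn_idPl nB).
elim: n nB hf => [|n IH] nB hf; first by rewrite big_nil.
rewrite big_nat_recr //= IH ?addBE ?(ltnW nB) // => [|i hi]; last by apply: hf; lia.
by rewrite (minn_idPl _) // hf.
Qed.

Definition mulB (B a b : nat) := sumB B a (fun=> b).

Lemma comp_mul F G : computable F -> computable G ->
  computable (fun x B T s => mulB B (F x B T s) (G x B T s)).
Proof. by rewrite /mulB; comp_tac. Qed.
#[local] Hint Resolve comp_mul : computable.

Lemma mulBE B a b : mulB B a b = minn a B * minn b B.
Proof.
rewrite /mulB /sumB /loop; elim: (minn a B) => //= k ->.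
by rewrite addBE mulSnr.
Qed.

Definition countB (B n : nat) (P : pred nat) :=
  loop B n (fun i a => if P i then a.+1 else a) 0.

Lemma comp_count FN P : computable FN ->
  computableb (fun x B T s => P x B T (nth 0 s 0) (drop 2 s)) ->
  computable (fun x B T s => countB B (FN x B T s) (fun i => P x B T i s)).
Proof. by rewrite /countB; comp_tac. Qed.
#[local] Hint Resolve comp_count : computable.

Lemma countBE B n P : countB B n P = count P (iota 0 (minn n B)).
Proof.
rewrite /countB /loop; elim: (minn n B) => // k IH.
rewrite -[in iota _ _]addn1 iotaD count_cat /= -IH addn0 add0n.
by case: (P k); rewrite ?addn1 ?addn0.
Qed.

Definition subB (B a b : nat) := countB B a (fun i => b <= i).

Lemma comp_sub F G : computable F -> computable G ->
  computable (fun x B T s => subB B (F x B T s) (G x B T s)).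
Proof. by rewrite /subB; comp_tac. Qed.
#[local] Hint Resolve comp_sub : computable.

Lemma subBE B a b : subB B a b = minn a B - b.
Proof.
rewrite /subB countBE; elim: (minn a B) => // k IH.
by rewrite -[in iota _ _]addn1 iotaD count_cat IH /=; case: leqP; lia.
Qed.

Definition divB (B a b : nat) := countB B a (fun q => mulB B q.+1 b <= a).

Lemma comp_div F G : computable F -> computable G ->
  computable (fun x B T s => divB B (F x B T s) (G x B T s)).
Proof. by rewrite /divB; comp_tac. Qed.
#[local] Hint Resolve comp_div : computable.

Lemma divBE B a b : a <= B -> 0 < b <= B -> divB B a b = a %/ b.
Proof.
move=> aB /andP[b0 bB]; rewrite /divB countBE (minn_idPl aB).
rewrite (@eq_in_count _ _ (fun q => q < a %/ b)); last first.
  move=> q; rewrite mem_iota /= add0n => qa; rewrite mulBE.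
  by rewrite (minn_idPl bB) (minn_idPl (leq_trans qa aB)) leq_divRL.
have : a %/ b <= a by apply: leq_div.
move: (a %/ b) => d /subnK <-; rewrite addnC iotaD count_cat add0n.
rewrite (@eq_in_count _ _ predT) => [|q]; last by rewrite mem_iota add0n => /andP[_ ->].
rewrite count_predT size_iota (@eq_in_count _ _ pred0) ?count_pred0 ?addn0 // => q.
by rewrite mem_iota /= => /andP[h _]; rewrite ltnNge h.
Qed.

Definition modB (B a b : nat) := subB B a (mulB B (divB B a b) b).

Lemma comp_mod F G : computable F -> computable G ->
  computable (fun x B T s => modB B (F x B T s) (G x B T s)).
Proof. by rewrite /modB; comp_tac. Qed.
#[local] Hint Resolve comp_mod : computable.

Lemma modBE B a b : a <= B -> 0 < b <= B -> modB B a b = a %% b.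
Proof.
move=> aB hb; have /andP[b0 bB] := hb.
rewrite /modB subBE divBE // mulBE (minn_idPl aB) (minn_idPl bB) (minn_idPl _).
  by rewrite {1}(divn_eq a b); lia.
exact: leq_trans (leq_div _ _) aB.
Qed.

Definition powB (B b e : nat) := loop B e (fun _ a => mulB B a b) 1.

Lemma comp_pow F G : computable F -> computable G ->
  computable (fun x B T s => powB B (F x B T s) (G x B T s)).
Proof. by rewrite /powB; comp_tac. Qed.
#[local] Hint Resolve comp_pow : computable.

(** Once the true power reaches [B], the capped one never falls below [B] again, since a product
    with a positive factor does not shrink. A computed power below [B] can thus be trusted, and this
    is how a program certifies its own bound. *)
Lemma powB_lt B b e : 1 < b -> powB B b e < B -> b ^ e < B.
Proof.
move=> b1 h.
have B1 : 0 < B by case: (B) h.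
have step k : iteri k (fun _ a => mulB B a b) 1 < B ->
    b ^ k < B.
  suff : (b ^ k < B -> iteri k (fun _ a => mulB B a b) 1 = b ^ k) /\
         (B <= b ^ k -> B <= iteri k (fun _ a => mulB B a b) 1).
    by move=> [_ h2] h3; rewrite ltnNge; apply/negP => /h2; rewrite leqNgt h3.
  elim: k => [|k [IH1 IH2]]; first by rewrite expn0; split.
  rewrite expnS /= mulBE; split=> hk.
    have bk : b ^ k < B by apply: leq_ltn_trans hk; rewrite leq_pmull // ltnW.
    rewrite IH1 // (minn_idPl (ltnW bk)) (minn_idPl _) 1?mulnC //.
    by apply: ltnW; apply: leq_ltn_trans hk; rewrite leq_pmulr // expn_gt0 ltnW.
  case: (ltnP (b ^ k) B) => bk.
    rewrite IH1 // (minn_idPl (ltnW bk)) /minn; case: ltnP => _; first by rewrite mulnC.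
    by rewrite leq_pmull // expn_gt0 ltnW.
  rewrite (minn_idPr (IH2 bk)) leq_pmulr // leq_min B1 andbT; exact: ltnW.
(* If [e] exceeds [B], only [B] rounds are made, but [b ^ B] is already greater than [B]. *)
move: h; rewrite /powB /loop; case: (leqP e B) => [_|eB] /step // bB.
by have := leq_ltn_trans (ltnW (ltn_expl B b1)) bB; rewrite ltnn.
Qed.

Lemma powBE B b e : 1 < b -> b ^ e < B -> powB B b e = b ^ e.
Proof.
move=> b1 h; have eB : e <= B by apply: ltnW; apply: leq_ltn_trans h; apply: ltnW; apply: ltn_expl.
rewrite /powB /loop (minn_idPl eB) {eB}; elim: e h => // k IH; rewrite expnS => hk /=.
have bk : b ^ k < B by apply: leq_ltn_trans hk; rewrite leq_pmull // ltnW.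
rewrite IH // mulBE (minn_idPl (ltnW bk)) (minn_idPl _) 1?mulnC //.
by apply: ltnW; apply: leq_ltn_trans hk; rewrite leq_pmulr // expn_gt0 ltnW.
Qed.

Lemma existsBP B n (P : pred nat) : n <= B ->
  reflect (exists2 i, i < n & P i) (existsB B n P).
Proof.
move=> nB; rewrite /existsB (minn_idPl nB); apply: (iffP hasP) => -[i hi Pi];
  by exists i; rewrite // mem_iota in hi *.
Qed.

Lemma forallBP B n (P : pred nat) : n <= B ->
  reflect (forall i, i < n -> P i) (forallB B n P).
Proof.
move=> nB; rewrite /forallB (minn_idPl nB); apply: (iffP allP) => H i hi;
  by apply: H; rewrite mem_iota in hi *.
Qed.

(** * Parsing *)

Definition lenB x B := countB B B (fun p => input x p != 4).
(** The number of separators before a position is the index of its field. A field is thus read by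
    counting over the whole input, without locating its ends. *)
Definition nsepB x B p := countB B p (fun q => input x q == 3).
Definition onesB x B f :=
  countB B (lenB x B) (fun p => (input x p == 1) && (nsepB x B p == f)).
Definition negB x B f :=
  existsB B (lenB x B) (fun p => (input x p == 2) && (nsepB x B p == f)).
(** One round of Horner's scheme. Bits are stored least significant first, so [binB] visits the
    positions backwards; the cap copes with numbers exponential in their length. *)
Definition bin_step x B f p a :=
  if (input x p <= 1) && (nsepB x B p == f) then
    if addB B (addB B a a) (input x p) <= B then addB B (addB B a a) (input x p) else B
  else a.
Definition binB x B f :=
  loop B (lenB x B) (fun i a => bin_step x B f (subB B (lenB x B) i.+1) a) 0.

Lemma comp_len : computable (fun x B T s => lenB x B).
Proof. by rewrite /lenB; comp_tac. Qed.
#[local] Hint Resolve comp_len : computable.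

Lemma comp_nsep F : computable F -> computable (fun x B T s => nsepB x B (F x B T s)).
Proof. by rewrite /nsepB; comp_tac. Qed.
#[local] Hint Resolve comp_nsep : computable.

Lemma comp_ones F : computable F -> computable (fun x B T s => onesB x B (F x B T s)).
Proof. by rewrite /onesB; comp_tac. Qed.
#[local] Hint Resolve comp_ones : computable.

Lemma compb_neg_field F : computable F -> computableb (fun x B T s => negB x B (F x B T s)).
Proof. by rewrite /negB; comp_tac. Qed.
#[local] Hint Resolve compb_neg_field : computable.

Lemma comp_bin F : computable F -> computable (fun x B T s => binB x B (F x B T s)).
Proof. by rewrite /binB /bin_step; comp_tac. Qed.
#[local] Hint Resolve comp_bin : computable.

(* Fields are numbered from 0 and include their separator. *)
Fixpoint nth_field (x : seq sym) (f : nat) : seq sym :=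
  match x, f with
  | [::], _ => [::]
  | c :: x, 0 => if sym_code c == 3 then [:: c] else c :: nth_field x 0
  | c :: x, f'.+1 => nth_field x (if sym_code c == 3 then f' else f)
  end.

Definition nsep (x : seq sym) (p : nat) := count (fun c => sym_code c == 3) (take p x).

Lemma filter_field x f :
  [seq nth S0 x p | p <- iota 0 (size x) & nsep x p == f] = nth_field x f.
Proof.
elim: x f => [|c x IH] f //=.
have tail g : [seq nth S0 (c :: x) p | p <- iota 1 (size x) & nsep (c :: x) p == g] =
    if sym_code c == 3 then if g is g'.+1 then nth_field x g' else [::] else nth_field x g.
  rewrite (iotaDl 1 0) filter_map -map_comp.
  transitivity [seq nth S0 x p | p <- iota 0 (size x) & (sym_code c == 3) + nsep x p == g].
    by congr map; apply: eq_filter.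
  case: (sym_code c == 3); last by rewrite -IH.
  case: g => [|g]; last by rewrite -IH.
  by rewrite (@eq_filter _ _ pred0) ?filter_pred0.
rewrite {1}/nsep take0 /=; case: f => [|f] /=; rewrite tail; by case: ifP.
Qed.

Definition no_sep (w : seq sym) := all (fun c => sym_code c != 3) w.

Definition join (ws : seq (seq sym)) := flatten [seq rcons w Ssep | w <- ws].

Lemma field_join ws f : all no_sep ws -> f < size ws ->
  nth_field (join ws) f = rcons (nth [::] ws f) Ssep.
Proof.
elim: ws f => [|w ws IH] f //= /andP[hw hws] hf; rewrite /join /= -/(join ws).
elim: w hw => [|c w IHw] /=.
  by case: f hf => // f hf _; apply: IH.
move=> /andP[/negbTE hc hw]; rewrite hc; move: (IHw hw).
by case: f {IHw} hf => [|f] hf /= ->.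
Qed.

Section Parse.

Variables (x : seq sym) (B : nat).
Hypothesis xB : size x < B.

Lemma input_nth p : p < size x -> input x p = sym_code (nth S0 x p).
Proof. by move=> hp; rewrite /input (nth_map S0). Qed.

Lemma nsepBE p : p <= size x -> nsepB x B p = nsep x p.
Proof.
move=> hp; rewrite /nsepB countBE (minn_idPl (leq_trans hp (ltnW xB))) /nsep.
elim: p hp => [|p IH] hp; first by rewrite take0.
rewrite -[in iota _ _]addn1 iotaD count_cat IH 1?ltnW // (take_nth S0) //.
by rewrite -cats1 count_cat /= add0n input_nth.
Qed.

Lemma lenBE : lenB x B = size x.
Proof.
rewrite /lenB countBE minnn -(subnK (ltnW xB)) addnC iotaD count_cat.
rewrite (@eq_in_count _ _ predT) => [|p]; last first.
  by rewrite mem_iota add0n => /andP[_ hp]; rewrite input_nth //; case: (nth _ _ _).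
rewrite count_predT size_iota (@eq_in_count _ _ pred0) ?count_pred0 ?addn0 // => p.
by rewrite mem_iota add0n => /andP[hp _]; rewrite /input nth_default ?size_map.
Qed.

Lemma count_field (P : pred nat) f :
  count (fun p => P (input x p) && (nsepB x B p == f)) (iota 0 (size x)) =
  count (fun c => P (sym_code c)) (nth_field x f).
Proof.
rewrite -filter_field count_map count_filter; apply: eq_in_count => p.
by rewrite mem_iota add0n => /andP[_ hp] /=; rewrite input_nth // nsepBE // ltnW.
Qed.

Lemma onesBE f : onesB x B f = count (fun c => sym_code c == 1) (nth_field x f).
Proof.
by rewrite /onesB countBE lenBE (minn_idPl (ltnW xB)) (count_field (fun a => a == 1)).
Qed.

Lemma negBE f : negB x B f = has (fun c => sym_code c == 2) (nth_field x f).
Proof.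
by rewrite /negB /existsB lenBE (minn_idPl (ltnW xB)) !has_count (count_field (fun a => a == 2)).
Qed.

Lemma iteri_foldr (A : Type) (g : nat -> A -> A) a n :
  iteri n (fun i a => g (n - i.+1) a) a = foldr g a (iota 0 n).
Proof.
suff H k : k <= n -> iteri k (fun i a => g (n - i.+1) a) a = foldr g a (iota (n - k) k).
  by rewrite H // subnn.
elim: k => [|k IH] hk //=; rewrite IH ?(ltnW hk) //.
by have -> : n - k = (n - k.+1).+1 by lia.
Qed.

Definition bin_value (w : seq sym) := foldr (fun c a => a.*2 + sym_code c) 0 w.

(** Capping in every round equals capping once at the end, because doubling and adding a bit is
    monotone and never decreases a value. *)
Lemma binBE f w : nth_field x f = rcons w Ssep -> all (fun c => sym_code c <= 1) w ->
  binB x B f = minn (bin_value w) B.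
Proof.
move=> hf hw; rewrite /binB /loop lenBE (minn_idPl (ltnW xB)).
have -> : iteri (size x) (fun i a => bin_step x B f (subB B (size x) i.+1) a) 0 =
    iteri (size x) (fun i a => bin_step x B f (size x - i.+1) a) 0.
  by apply: eq_iteri => i a; rewrite subBE (minn_idPl (ltnW xB)).
rewrite iteri_foldr.
pose g c a := if sym_code c <= 1 then minn (a.*2 + sym_code c) B else a.
have gE c a : g c a = if sym_code c <= 1 then minn (a.*2 + sym_code c) B else a by [].
have [h1 h2] : foldr (bin_step x B f) 0 (iota 0 (size x)) = foldr g 0 (nth_field x f) /\
    foldr g 0 (nth_field x f) <= B.
  rewrite -filter_field; have : {subset iota 0 (size x) <= gtn (size x)}.
    by move=> p; rewrite mem_iota.
  elim: (iota _ _) => [|p l IH] hl //=.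
  have hp : p < size x by apply: hl; rewrite mem_head.
  have [|-> le] := IH; first by move=> q hq; apply: hl; rewrite inE hq orbT.
  rewrite /bin_step input_nth // (nsepBE (ltnW hp)).
  case: (nsep x p == f); rewrite ?andbT ?andbF //=.
  rewrite !gE; case: ifP => // h1; split; last by rewrite geq_minr.
  rewrite !addBE (minn_idPl le) (minn_idPl (leq_trans h1 _)); last lia.
  by rewrite addnn; case: leqP.
rewrite h1 hf {h1 h2} -cats1 foldr_cat {2}/g /=.
elim: w {hf} hw => [|c w IH] /=; first by rewrite min0n.
by move=> /andP[hc /IH ->]; rewrite /g hc; lia.
Qed.

End Parse.

Definition bits (m : nat) : seq sym :=
  match bin_of_nat m with
  | BinNums.N0 => [::]
  | BinNums.Npos p => pbits p
  end.

Lemma binaryE m : binary m = rcons (bits m) Ssep.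
Proof. by rewrite /binary -cats1. Qed.

Lemma bin_value_bits m : bin_value (bits m) = m.
Proof.
rewrite -[RHS]bin_of_natK /bits; case: (bin_of_nat m) => //= p.
by elim: p => [p IH|p IH|] /=; rewrite ?NatTrec.doubleE ?IH ?addn1 ?addn0.
Qed.

Lemma bits_le1 m : all (fun c => sym_code c <= 1) (bits m).
Proof. by rewrite /bits; case: (bin_of_nat m) => //=; elim. Qed.

Lemma no_sep_bits m : no_sep (bits m).
Proof. by apply: sub_all (bits_le1 m) => c; case: (sym_code c) => [|[]]. Qed.

Definition int_word (z : int) : seq sym :=
  match z with Posz m => nseq m S1 | Negz m => Sneg :: nseq m.+1 S1 end.

Lemma enc_intE z : enc_int z = rcons (int_word z) Ssep.
Proof. by rewrite -cats1; case: z. Qed.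

Lemma no_sep_ones m : no_sep (nseq m S1).
Proof. by rewrite /no_sep all_nseq orbT. Qed.

Lemma no_sep_int z : no_sep (int_word z).
Proof. by case: z => m; rewrite /= ?no_sep_ones // /no_sep /= all_nseq orbT. Qed.

Lemma count_ones_int z : count (fun c => sym_code c == 1) (rcons (int_word z) Ssep) = `|z|%N.
Proof. by rewrite -cats1 count_cat addn0; case: z => m; rewrite /= count_nseq ?mul1n. Qed.

Lemma has_neg_int z : has (fun c => sym_code c == 2) (rcons (int_word z) Ssep) = (z < 0)%R.
Proof. by rewrite has_rcons /=; case: z => m //=; rewrite has_nseq andbF. Qed.

Lemma nth_flatten_const (A : Type) (x0 : A) (ss : seq (seq A)) m i j :
  all (fun s => size s == m) ss -> i < size ss -> j < m ->
  nth x0 (flatten ss) (i * m + j) = nth x0 (nth [::] ss i) j.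
Proof.
elim: ss i => [|s ss IH] i //= /andP[/eqP hs hss] hi hj.
rewrite nth_cat hs; case: i hi => [|i] hi; first by rewrite add0n hj.
by rewrite mulSn -addnA ltnNge leq_addr /= addKn IH.
Qed.

Lemma size_flatten_const (A : Type) (ss : seq (seq A)) m :
  all (fun s => size s == m) ss -> size (flatten ss) = size ss * m.
Proof.
elim: ss => [|s ss IH] //= /andP[/eqP hs /IH h].
by rewrite size_cat hs h mulSn.
Qed.

(** * The algorithm *)

Section Program.

Variables lbB ubB : seq sym -> nat -> nat -> nat.
Hypothesis comp_lb : forall F, computable F -> computable (fun x B T s => lbB x B (F x B T s)).
Hypothesis comp_ub : forall F, computable F -> computable (fun x B T s => ubB x B (F x B T s)).
Hint Resolve comp_lb comp_ub : computable.

Definition nB x B := onesB x B 0.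
Definition kB x B := binB x B 1.
(** Fields 0 and 1 hold [n] and [k]; the valuation matrix follows row by row. *)
Definition magB x B i j := onesB x B (addB B (mulB B i (nB x B)) j).+2.
Definition isnegB x B i j := negB x B (addB B (mulB B i (nB x B)) j).+2.
Definition uvB x B i j :=
  if isnegB x B i j then subB B (lenB x B) (magB x B i j)
  else addB B (lenB x B) (magB x B i j).
(** Powers of [beta = (|x| + 2) ^ 3]. The cube suffices because a digit never exceeds
    [n * (2|x| + 1)] with [n] at most [|x|]. *)
Definition bpowB x B e := powB B (lenB x B).+2 (mulB B 3 e).
Definition digB x B s a := modB B (divB B s (bpowB x B a)) (bpowB x B 1).

Definition coverB x B v C :=
  forallB B (nB x B) (fun i => forallB B (nB x B) (fun j =>
    (magB x B i j != 0) ==>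
    existsB B v (fun a => (digB x B C a == i) || (digB x B C a == j)))) &&
  (forallB B v (fun a => digB x B C a < nB x B) &&
   forallB B v (fun a => forallB B v (fun b => (digB x B C a == digB x B C b) ==> (a == b)))).

Definition inlabB x B v L l := existsB B v (fun a => digB x B L a == l).

(** Outside the cover this is individual rationality: each of the [v] summands is shifted by [|x|],
    so utility 0 corresponds to [v * |x|]. A cover vertex is only tied to its guessed label here;
    its utility depends on all agents and is tested by [finalB]. *)
Definition allowedB x B v C L i l :=
  if existsB B v (fun a => digB x B C a == i)
  then forallB B v (fun a => (digB x B C a == i) ==> (digB x B L a == l))
  else mulB B v (lenB x B) <=
    sumB B v (fun b => if digB x B L b == l then uvB x B i (digB x B C b) else lenB x B).

(* Digit [e] of the weight of agent [i] in coalition [l]: its share of the utility of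
   cover vertex [e], shifted by [|x|] to be nonnegative ([e < v]), of the size of the
   coalition of that vertex ([v <= e < 2v]), or of the number of agents outside the
   coalitions of the cover ([e = 2v]). *)
Definition contribB x B v C L i l e : nat :=
  if e < v then if digB x B L e == l then uvB x B (digB x B C e) i else lenB x B
  else if e < addB B v v then nat_of_bool (digB x B L (subB B e v) == l)
  else nat_of_bool (~~ inlabB x B v L l).

Definition weightB x B v C L i l :=
  sumB B (addB B v v).+1 (fun e => mulB B (contribB x B v C L i l e) (bpowB x B e)).

Definition blockB x B v := bpowB x B (addB B v v).+1.

(** Entry [i * blockB + s] says whether the first [i] agents can be placed with total weight [s].
    Comparing the weight with the remainder of [p] keeps the subtraction from running into an
    earlier row. *)
Definition ruleB x B v C L p (T : seq bool) :=
  if p < blockB x B v then p == 0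
  else existsB B (kB x B) (fun l =>
    allowedB x B v C L (subB B (divB B p (blockB x B v)) 1) l &&
    ((weightB x B v C L (subB B (divB B p (blockB x B v)) 1) l <= modB B p (blockB x B v)) &&
     nth false T (subB B (subB B p (blockB x B v))
                    (weightB x B v C L (subB B (divB B p (blockB x B v)) 1) l)))).

(** Each of the [n] agents adds a shift of [|x|] to a utility digit, so utility 0 corresponds to
    [n * |x|]. The last two tests are the condition under which the agents counted in the final
    digit can be spread over the coalitions that avoid the cover. *)
Definition finalB x B v L s :=
  forallB B v (fun b =>
    (mulB B (nB x B) (lenB x B) <= digB x B s b) &&
    ((lbB x B (digB x B L b) <= digB x B s (addB B v b)) &&
     (digB x B s (addB B v b) <= ubB x B (digB x B L b)))) &&
  ((sumB B (kB x B) (fun l => if inlabB x B v L l then 0 else lbB x B l)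
      <= digB x B s (addB B v v)) &&
   (digB x B s (addB B v v) <=
      sumB B (kB x B) (fun l => if inlabB x B v L l then 0 else ubB x B l))).

Definition reachB x B v L (T : seq bool) :=
  existsB B (blockB x B v) (fun s =>
    nth false T (addB B (mulB B (nB x B) (blockB x B v)) s) && finalB x B v L s).

Definition tableB x B v C L :=
  table B (mulB B (nB x B).+1 (blockB x B v)) (fun p T => ruleB x B v C L p T).

(** The table has [n + 1] rows of [beta ^ (2v + 1)] entries, at most [beta ^ (2v + 2)] in all, so
    the exponent [2v + 3] makes every table index fit below [B]. *)
Definition enoughB x B v := bpowB x B (addB B (addB B v v) 3) < B.

(* 0: [B] is too small; 1: no solution; 2: a solution exists. *)
Definition resultB x B : nat :=
  if lenB x B < B then
    if kB x B <= lenB x B then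
      if existsB B B (fun v => enoughB x B v &&
           existsB B (bpowB x B v) (fun C => coverB x B v C)) then
        if existsB B B (fun v => enoughB x B v &&
             existsB B (bpowB x B v) (fun C => coverB x B v C &&
               existsB B (bpowB x B v) (fun L => reachB x B v L (tableB x B v C L))))
        then 2 else 1
      else 0
    else 1
  else 0.

Lemma comp_n : computable (fun x B T s => nB x B).
Proof. by rewrite /nB; comp_tac. Qed.
Hint Resolve comp_n : computable.

Lemma comp_k : computable (fun x B T s => kB x B).
Proof. by rewrite /kB; comp_tac. Qed.
Hint Resolve comp_k : computable.

Lemma comp_mag F G : computable F -> computable G ->
  computable (fun x B T s => magB x B (F x B T s) (G x B T s)).
Proof. by rewrite /magB; comp_tac. Qed.
Hint Resolve comp_mag : computable.

Lemma comp_uv F G : computable F -> computable G ->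
  computable (fun x B T s => uvB x B (F x B T s) (G x B T s)).
Proof. by rewrite /uvB /isnegB; comp_tac. Qed.
Hint Resolve comp_uv : computable.

Lemma comp_bpow F : computable F -> computable (fun x B T s => bpowB x B (F x B T s)).
Proof. by rewrite /bpowB; comp_tac. Qed.
Hint Resolve comp_bpow : computable.

Lemma comp_dig F G : computable F -> computable G ->
  computable (fun x B T s => digB x B (F x B T s) (G x B T s)).
Proof. by rewrite /digB; comp_tac. Qed.
Hint Resolve comp_dig : computable.

Lemma comp_cover Fv FC : computable Fv -> computable FC ->
  computableb (fun x B T s => coverB x B (Fv x B T s) (FC x B T s)).
Proof. by rewrite /coverB; comp_tac. Qed.
Hint Resolve comp_cover : computable.

Lemma comp_inlab Fv FL Fl : computable Fv -> computable FL -> computable Fl ->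
  computableb (fun x B T s => inlabB x B (Fv x B T s) (FL x B T s) (Fl x B T s)).
Proof. by rewrite /inlabB; comp_tac. Qed.
Hint Resolve comp_inlab : computable.

Lemma comp_allowed Fv FC FL Fi Fl :
  computable Fv -> computable FC -> computable FL -> computable Fi -> computable Fl ->
  computableb (fun x B T s => allowedB x B (Fv x B T s) (FC x B T s) (FL x B T s)
    (Fi x B T s) (Fl x B T s)).
Proof. by rewrite /allowedB; comp_tac. Qed.
Hint Resolve comp_allowed : computable.

Lemma comp_weight Fv FC FL Fi Fl :
  computable Fv -> computable FC -> computable FL -> computable Fi -> computable Fl ->
  computable (fun x B T s => weightB x B (Fv x B T s) (FC x B T s) (FL x B T s)
    (Fi x B T s) (Fl x B T s)).
Proof. by rewrite /weightB /contribB; comp_tac. Qed.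
Hint Resolve comp_weight : computable.

Lemma comp_block Fv : computable Fv -> computable (fun x B T s => blockB x B (Fv x B T s)).
Proof. by rewrite /blockB; comp_tac. Qed.
Hint Resolve comp_block : computable.

Lemma comp_rule Fv FC FL Fp :
  computable Fv -> computable FC -> computable FL -> computable Fp ->
  computableb (fun x B T s => ruleB x B (Fv x B T s) (FC x B T s) (FL x B T s) (Fp x B T s) T).
Proof. by rewrite /ruleB; comp_tac. Qed.

Lemma comp_final Fv FL Fs : computable Fv -> computable FL -> computable Fs ->
  computableb (fun x B T s => finalB x B (Fv x B T s) (FL x B T s) (Fs x B T s)).
Proof. by rewrite /finalB; comp_tac. Qed.
Hint Resolve comp_final : computable.

Lemma comp_reach Fv FL : computable Fv -> computable FL ->
  computableb (fun x B T s => reachB x B (Fv x B T s) (FL x B T s) T).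
Proof. by rewrite /reachB; comp_tac. Qed.

(** The arguments may consult the current table, which is replaced while the new one is built. They
    are therefore evaluated first and bound to variables. *)
Lemma comp_reach_table Fv FC FL : computable Fv -> computable FC -> computable FL ->
  computableb (fun x B T s => reachB x B (Fv x B T s) (FL x B T s)
    (tableB x B (Fv x B T s) (FC x B T s) (FL x B T s))).
Proof.
move=> hv hC hL.
have vars i : computable (fun x B T s => nth 0 s i) by comp_tac.
have H : computableb (fun x B T s => reachB x B (nth 0 s 0) (nth 0 s 2)
    (tableB x B (nth 0 s 0) (nth 0 s 1) (nth 0 s 2))).
  refine (compb_lettab (Q := fun x B T s => reachB x B (nth 0 s 0) (nth 0 s 2) T)
    (P := fun x B T i s => ruleB x B (nth 0 s 0) (nth 0 s 1) (nth 0 s 2) i T) _ _ _).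
  - comp_tac.
  - by apply: comp_rule; comp_tac.
  - by apply: comp_reach.
have [e he] := compb_let hL (compb_let (comp_shift hC (shift_drop 1 shift_id))
  (compb_let (comp_shift hv (shift_drop 2 shift_id)) H)).
by exists e => x B T s; rewrite he /= drop0.
Qed.
Hint Resolve comp_reach_table : computable.

Lemma comp_enough Fv : computable Fv -> computableb (fun x B T s => enoughB x B (Fv x B T s)).
Proof. by rewrite /enoughB; comp_tac. Qed.
Hint Resolve comp_enough : computable.

Lemma comp_result : computable (fun x B T s => resultB x B).
Proof. by rewrite /resultB; comp_tac. Qed.

End Program.

(** * Digits and distributions *)

Section Digits.

Variable beta : nat.

Definition dig (s a : nat) := (s %/ beta ^ a) %% beta.

Definition of_digits (K : nat) (d : nat -> nat) := \sum_(0 <= e < K) d e * beta ^ e.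

Lemma of_digits_lt K d : (forall e, e < K -> d e < beta) -> of_digits K d < beta ^ K.
Proof.
rewrite /of_digits; elim: K => [|K IH] hd; first by rewrite big_nil.
rewrite big_nat_recr //= expnS.
have h1 := IH (fun e he => hd e (ltnW he)); have h2 := hd K (leqnn _).
apply: (@leq_trans ((d K).+1 * beta ^ K)); first by rewrite mulSn; lia.
by rewrite leq_mul2r h2 orbT.
Qed.

Lemma dig_of_digits K d a : (forall e, e < K -> d e < beta) -> a < K ->
  dig (of_digits K d) a = d a.
Proof.
rewrite /of_digits; elim: K => // K IH hd; rewrite ltnS leq_eqVlt big_nat_recr //= => ha.
have b0 : 0 < beta by apply: leq_trans (hd K _).
have h1 : forall e, e < K -> d e < beta by move=> e he; apply: hd; lia.
case/orP: ha => [/eqP->|ha].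
  rewrite /dig addnC divnMDl ?expn_gt0 ?b0 // divn_small ?addn0 ?modn_small //.
    exact: hd.
  exact: of_digits_lt h1.
have eK : d K * beta ^ K = d K * beta ^ (K - a).-1 * beta * beta ^ a.
  by rewrite -!mulnA -expnS -expnD; congr (_ * _ ^ _); lia.
by rewrite -(IH h1 ha) /dig eK addnC divnMDl ?expn_gt0 ?b0 // modnMDl.
Qed.

End Digits.

Lemma sub_count n (O : pred nat) r : r <= \sum_(0 <= j < n) O j ->
  exists O' : pred nat, (forall j, O' j -> O j) /\ \sum_(0 <= j < n) O' j = r.
Proof.
elim: n => [|n IH]; first by rewrite big_nil leqn0 => /eqP->; exists pred0; rewrite big_nil.
rewrite big_nat_recr //= => hr.
case: (leqP r (\sum_(0 <= j < n) O j)) => [/IH [O' [h1 h2]]|h].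
  exists (fun j => O' j && (j < n)); split=> [j /andP[/h1 //]|].
  rewrite big_nat_recr //= ltnn andbF addn0 -h2; apply: eq_big_nat => j /andP[_ ->].
  by rewrite andbT.
by exists O; split=> //; rewrite big_nat_recr //=; move: hr; case: (O n); lia.
Qed.

(** Induction on the number of labels: the last one takes as few agents as its lower bound and the
    capacity of the other labels permit, and the rest still meets both inequalities. *)
Lemma distribute n k (O L : pred nat) (lb ub : nat -> nat) :
  (forall l, lb l <= ub l) ->
  \sum_(0 <= l < k | L l) lb l <= \sum_(0 <= j < n) O j ->
  \sum_(0 <= j < n) O j <= \sum_(0 <= l < k | L l) ub l ->
  exists h : nat -> nat,
    (forall j, j < n -> O j -> (h j < k) && L (h j)) /\
    (forall l, l < k -> L l -> lb l <= \sum_(0 <= j < n) (O j && (h j == l)) <= ub l).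
Proof.
move=> lbub; elim: k O => [|k IH] O.
  rewrite !big_nil => _; rewrite leqn0 => /eqP h0.
  exists (fun=> 0); split=> // j hj Oj.
  move: h0; rewrite (@big_cat_nat _ _ _ j) //=; last exact: ltnW.
  by rewrite (@big_ltn _ _ _ j) // Oj; lia.
have recr f : \sum_(0 <= l < k.+1 | L l) f l =
    \sum_(0 <= l < k | L l) f l + (if L k then f k else 0).
  by rewrite big_mkcond big_nat_recr //= -big_mkcond.
rewrite !recr.
set m := \sum_(0 <= j < n) O j; set slb := \sum_(0 <= l < k | _) lb l.
set sub := \sum_(0 <= l < k | _) ub l.
have lsu : slb <= sub by apply: leq_sum => l _; apply: lbub.
case: (boolP (L k)) => Lk; rewrite ?addn0 => h1 h2.
  (* At most [sub] agents may be left for the smaller labels. This [r] is at most [ub k] because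
     [m <= sub + ub k], and it leaves at least [slb] agents because [slb + lb k <= m] and
     [slb <= sub]. *)
  pose r := maxn (lb k) (m - sub).
  have lu := lbub k.
  have [|O' [sO' cO']] := @sub_count n O r; first by rewrite -/m /r; lia.
  have split_sum : \sum_(0 <= j < n) O j = r + \sum_(0 <= j < n) (O j && ~~ O' j).
    rewrite -cO' -big_split /=; apply: eq_bigr => j _.
    by move: (sO' j); case: (O' j) => [->|] //=; case: (O j).
  have [||h [hh1 hh2]] := IH (fun j => O j && ~~ O' j); rewrite -/slb -/sub.
  - by move: split_sum; rewrite -/m /r; lia.
  - by move: split_sum; rewrite -/m /r; lia.
  exists (fun j => if O' j then k else h j); split=> [j hj Oj|l].
    case: ifP => O'j; first by rewrite leqnn.
    have := hh1 j hj; rewrite Oj O'j => /(_ isT) /andP[hk ->].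
    by rewrite ltnS ltnW.
  rewrite ltnS leq_eqVlt => /orP[/eqP-> _|lk Ll].
    have -> : \sum_(0 <= j < n) (O j && ((if O' j then k else h j) == k)) = r.
      rewrite -cO'; apply: eq_big_nat => j /andP[_ hj].
      case: ifP => O'j; first by rewrite eqxx andbT (sO' _ O'j).
      case Oj: (O j) => //=; have := hh1 j hj; rewrite Oj O'j => /(_ isT) /andP[hk _].
      by rewrite ltn_eqF.
    by rewrite /r; lia.
  have := hh2 l lk Ll.
  have -> // : \sum_(0 <= j < n) (O j && ~~ O' j && (h j == l)) =
    \sum_(0 <= j < n) (O j && ((if O' j then k else h j) == l)).
  apply: eq_bigr => j _; case: (O' j); rewrite ?andbF ?andbT //=.
  by rewrite gtn_eqF // andbF.
have [h [hh1 hh2]] := IH O h1 h2.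
exists h; split=> [j hj Oj|l].
  by have /andP[hk ->] := hh1 j hj Oj; rewrite ltnS ltnW.
by rewrite ltnS leq_eqVlt => /orP[/eqP->|lk]; [rewrite (negbTE Lk)|apply: hh2].
Qed.

(** * Correctness of the dynamic program *)

Section Core.

Variables (n k v U beta : nat) (V : nat -> nat -> int) (lb ub : nat -> nat) (c : nat -> nat).

Hypothesis VU : forall i j, i < n -> j < n -> `|V i j|%N <= U.
Hypothesis lbub : forall l, lb l <= ub l.
Hypothesis beta_gt : n * (U + U).+1 < beta.
Hypothesis c_lt : forall a, a < v -> c a < n.
Hypothesis c_inj : forall a b, a < v -> b < v -> c a = c b -> a = b.
Hypothesis c_cover : forall i j, i < n -> j < n -> V i j <> 0%R ->
  exists2 a, a < v & (c a == i) || (c a == j).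

Definition valid (f : nat -> nat) :=
  [/\ forall j, j < n -> f j < k,
      forall i, i < n -> (0 <= \sum_(0 <= j < n | f j == f i) V i j)%R &
      forall l, l < k -> lb l <= \sum_(0 <= j < n) (f j == l) <= ub l].

Definition uv i j : nat := if (V i j < 0)%R then U - `|V i j|%N else U + `|V i j|%N.

Section Labels.

Variable g : nat -> nat.

Definition in_cover i := has (fun a => c a == i) (iota 0 v).
Definition in_lab l := has (fun a => g a == l) (iota 0 v).

Definition allowed i l :=
  if in_cover i then all (fun a => (c a == i) ==> (g a == l)) (iota 0 v)
  else v * U <= \sum_(0 <= b < v) (if g b == l then uv i (c b) else U).

Definition contrib i l e : nat :=
  if e < v then if g e == l then uv (c e) i else U
  else if e < v + v then nat_of_bool (g (e - v) == l)
  else nat_of_bool (~~ in_lab l).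

Definition weight i l := of_digits beta (v + v).+1 (contrib i l).

Definition final s :=
  all (fun b => (n * U <= dig beta s b) &&
     ((lb (g b) <= dig beta s (v + b)) && (dig beta s (v + b) <= ub (g b)))) (iota 0 v) &&
  ((\sum_(0 <= l < k) (if in_lab l then 0 else lb l) <= dig beta s (v + v)) &&
   (dig beta s (v + v) <= \sum_(0 <= l < k) (if in_lab l then 0 else ub l))).

Definition admissible i (f : nat -> nat) := forall j, j < i -> (f j < k) && allowed j (f j).

Lemma in_coverP i : reflect (exists2 a, a < v & c a = i) (in_cover i).
Proof.
by apply: (iffP hasP) => -[a ha /eqP h]; exists a; rewrite ?mem_iota // in ha *; apply/eqP.
Qed.

Lemma in_labP l : reflect (exists2 a, a < v & g a = l) (in_lab l).
Proof.
by apply: (iffP hasP) => -[a ha /eqP h]; exists a; rewrite ?mem_iota // in ha *; apply/eqP.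
Qed.

Lemma uvE i j : i < n -> j < n -> ((uv i j)%:Z = V i j + U%:Z)%R.
Proof. by move=> hi hj; have := VU hi hj; rewrite /uv; case: ifP; lia. Qed.

Lemma uv_le i j : i < n -> j < n -> uv i j <= U + U.
Proof. by move=> hi hj; have := VU hi hj; rewrite /uv; case: ifP; lia. Qed.

Lemma sum_uv m (t : nat -> nat) (P : pred nat) i : i < n -> (forall j, j < m -> t j < n) ->
  ((\sum_(0 <= j < m) (if P j then uv i (t j) else U))%N%:Z =
   (m * U)%N%:Z + \sum_(0 <= j < m | P j) V i (t j))%R.
Proof.
move=> hi ht; rewrite [in RHS]big_mkcond /=.
elim: m ht => [|m IH] ht; first by rewrite !big_nil.
rewrite !big_nat_recr //= PoszD IH => [|j hj]; last by apply: ht; lia.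
have := uvE hi (ht m (leqnn _)); case: (P m); lia.
Qed.

Lemma contrib_lt i l e : i < n -> l < k -> e < (v + v).+1 -> contrib i l e <= U + U + 1.
Proof.
move=> hi hl he; rewrite /contrib; case: ifP => ev.
  by case: ifP => _; [have := uv_le (c_lt ev) hi|]; lia.
by case: ifP => _; apply: leq_trans (leq_b1 _) _; lia.
Qed.

Lemma sum_weight m f : \sum_(0 <= j < m) weight j (f j) =
  of_digits beta (v + v).+1 (fun e => \sum_(0 <= j < m) contrib j (f j) e).
Proof.
rewrite /weight /of_digits exchange_big /=; apply: eq_bigr => e _.
by rewrite big_distrl.
Qed.

(** This is the absence of carries: it lets the digits of a sum of weights be computed as sums of
    digits. *)
Lemma sum_contrib_lt m f e : m <= n -> (forall j, j < m -> f j < k) -> e < (v + v).+1 ->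
  \sum_(0 <= j < m) contrib j (f j) e < beta.
Proof.
move=> hm hf he; apply: leq_ltn_trans beta_gt.
apply: (@leq_trans (\sum_(0 <= j < m) (U + U).+1)).
  rewrite big_nat_cond [X in _ <= X]big_nat_cond; apply: leq_sum => j /andP[/andP[_ hj] _].
  by rewrite -addn1; apply: contrib_lt => //; [lia|exact: hf].
by rewrite sum_nat_const_nat subn0 leq_mul2r hm orbT.
Qed.

Lemma dig_sum_weight f e : (forall j, j < n -> f j < k) -> e < (v + v).+1 ->
  dig beta (\sum_(0 <= j < n) weight j (f j)) e = \sum_(0 <= j < n) contrib j (f j) e.
Proof.
move=> hf he; rewrite sum_weight dig_of_digits // => e' he'.
exact: sum_contrib_lt.
Qed.

Lemma sum_weight_lt m f : m <= n -> (forall j, j < m -> f j < k) ->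
  \sum_(0 <= j < m) weight j (f j) < beta ^ (v + v).+1.
Proof. by move=> hm hf; rewrite sum_weight; apply: of_digits_lt => e he; apply: sum_contrib_lt. Qed.

(** Injectivity of [c] is essential: a sum over positions in the cover has to count each cover
    vertex once. *)
Lemma sum_off_cover (F : nat -> int) :
  (forall j, j < n -> ~~ in_cover j -> F j = 0%R) ->
  (\sum_(0 <= j < n) F j = \sum_(0 <= b < v) F (c b))%R.
Proof.
move=> hF; rewrite -(big_map c xpredT F).
have mE j : j < n -> (j \in map c (iota 0 v)) = in_cover j.
  move=> hj; apply/mapP/in_coverP => -[a ha h]; exists a => //.
    by rewrite mem_iota in ha.
  by rewrite mem_iota.
have : perm_eq (map c (iota 0 v)) [seq j <- iota 0 n | j \in map c (iota 0 v)].
  apply: uniq_perm.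
  - rewrite map_inj_in_uniq ?iota_uniq // => a b; rewrite !mem_iota !add0n => ha hb.
    exact: c_inj.
  - by rewrite filter_uniq // iota_uniq.
  - move=> j; rewrite mem_filter mem_iota add0n /=.
    case: (boolP (j \in _)) => //= /mapP[a]; rewrite mem_iota add0n => ha ->.
    by rewrite c_lt.
rewrite /index_iota !subn0 => hp; rewrite [RHS](perm_big _ hp) big_filter.
rewrite [RHS]big_mkcond /= big_seq [RHS]big_seq; apply: eq_bigr => j.
rewrite mem_iota add0n => /andP[_ hj]; case: ifP => // hm.
by apply: hF => //; rewrite -mE // hm.
Qed.

(** Agents outside the cover have value 0 for each other, since every arc meets the cover; only
    cover vertices contribute. *)
Lemma utility_off_cover f i : i < n -> ~~ in_cover i -> (forall a, a < v -> f (c a) = g a) ->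
  ((\sum_(0 <= b < v) (if g b == f i then uv i (c b) else U))%N%:Z =
   (v * U)%N%:Z + \sum_(0 <= j < n | f j == f i) V i j)%R.
Proof.
move=> hi hc hf; rewrite sum_uv //; congr (_ + _)%R.
rewrite [RHS]big_mkcond sum_off_cover => [|j hj hcj]; last first.
  case: ifP => // _; apply/eqP; apply: contraT => /eqP /c_cover [] // a ha.
  by case/orP => /eqP h; [case/in_coverP: hc|case/in_coverP: hcj]; exists a.
rewrite -big_mkcond /= big_nat_cond [RHS]big_nat_cond; apply: eq_bigl => b.
by case: (ltnP b v) => hb; rewrite ?andbF //= hf.
Qed.

Lemma sum_size f b : b < v ->
  \sum_(0 <= j < n) contrib j (f j) (v + b) = \sum_(0 <= j < n) (f j == g b).
Proof.
move=> hb; apply: eq_bigr => j _.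
by rewrite /contrib ltnNge leq_addr /= ltn_add2l hb addKn eq_sym.
Qed.

Lemma sum_others f :
  \sum_(0 <= j < n) contrib j (f j) (v + v) = \sum_(0 <= j < n) ~~ in_lab (f j).
Proof. by apply: eq_bigr => j _; rewrite /contrib ltnNge leq_addr /= ltnn. Qed.

Lemma sum_others_label f : (forall j, j < n -> f j < k) ->
  \sum_(0 <= j < n) ~~ in_lab (f j) =
  \sum_(0 <= l < k) (if in_lab l then 0 else \sum_(0 <= j < n) (f j == l)).
Proof.
move=> hf.
transitivity (\sum_(0 <= l < k) \sum_(0 <= j < n) (~~ in_lab l && (f j == l))).
  rewrite exchange_big /= big_nat_cond [RHS]big_nat_cond; apply: eq_bigr => j.
  move=> /andP[/andP[_ /hf hj] _].
  rewrite (@big_cat_nat _ _ _ (f j)) ?(ltnW hj) //= (@big_ltn _ _ _ (f j)) // eqxx andbT.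
  rewrite big_nat_cond big1 ?add0n => [|l /andP[/andP[_ hl] _]]; last first.
    by rewrite gtn_eqF ?andbF.
  rewrite big_nat_cond big1 ?addn0 // => l /andP[/andP[hl _] _].
  by rewrite ltn_eqF ?andbF.
apply: eq_bigr => l _; case: (in_lab l) => //=.
by rewrite big1.
Qed.

End Labels.

Theorem valid_admissible f g : valid f -> (forall a, a < v -> f (c a) = g a) ->
  admissible g n f /\ final g (\sum_(0 <= j < n) weight g j (f j)).
Proof.
move=> [hk hu hs] fg; split=> [j hj|].
  rewrite hk //= /allowed; case: ifP => hc.
    by apply/allP => a; rewrite mem_iota => ha; apply/implyP => /eqP <-; rewrite fg.
  have := utility_off_cover hj (negbT hc) fg.
  by have := hu j hj; lia.
have others : \sum_(0 <= j < n) contrib g j (f j) (v + v) =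
    \sum_(0 <= l < k) (if in_lab g l then 0 else \sum_(0 <= j < n) (f j == l)).
  by rewrite sum_others sum_others_label.
apply/andP; split; last first.
  rewrite dig_sum_weight // others !big_nat; apply/andP; split;
    by apply: leq_sum => l /andP[_ hl]; case: ifP => // _; case/andP: (hs l hl).
apply/allP => b; rewrite mem_iota add0n => /andP[_ hb].
rewrite !dig_sum_weight //; [|lia|lia].
rewrite sum_size // hs ?andbT; last by rewrite -fg //; apply: hk; apply: c_lt.
have -> : \sum_(0 <= j < n) contrib g j (f j) b =
    \sum_(0 <= j < n) (if f j == g b then uv (c b) (id j) else U).
  by apply: eq_bigr => j _; rewrite /contrib hb eq_sym.
have := sum_uv (fun j => f j == g b) (c_lt hb) (fun j hj => hj : id j < n).
by have := hu _ (c_lt hb); rewrite fg //=; lia.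
Qed.

(** The given labelling respects the size bounds of the coalitions of cover vertices, but for the
    others only the total number of agents is controlled. A solution is obtained by redistributing
    these agents. *)
Theorem admissible_valid g f : admissible g n f -> final g (\sum_(0 <= j < n) weight g j (f j)) ->
  exists f, valid f.
Proof.
move=> hp; have hk j : j < n -> f j < k by move=> /hp /andP[].
rewrite /final dig_sum_weight // => /andP[/allP hb].
rewrite sum_others.
have mk F : \sum_(0 <= l < k) (if in_lab g l then 0 else F l) =
    \sum_(0 <= l < k | ~~ in_lab g l) F l.
  by rewrite [RHS]big_mkcond; apply: eq_bigr => l _; case: (in_lab g l).
rewrite !mk => /andP[h1 h2].
have [h [hh1 hh2]] := distribute lbub h1 h2.
(* Members of coalitions that meet the cover stay, and the others move only among labels without a
   cover vertex. Membership in each coalition of a cover vertex is unchanged, hence so are the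
   utilities of the cover vertices. *)
pose f' j := if in_lab g (f j) then f j else h j.
have hk' j : j < n -> f' j < k.
  by move=> hj; rewrite /f'; case: ifP => hl; [exact: hk|case/andP: (hh1 j hj (negbT hl))].
have lab' j : j < n -> in_lab g (f' j) = in_lab g (f j).
  move=> hj; rewrite /f'; case: ifP => // hl.
  by case/andP: (hh1 j hj (negbT hl)) => _ /negbTE.
have eqg b j : b < v -> j < n -> (f' j == g b) = (f j == g b).
  move=> hb' hj; have hg : in_lab g (g b) by apply/in_labP; exists b.
  case: (boolP (in_lab g (f j))) => hl; first by rewrite /f' hl.
  apply/eqP/eqP => h'; last by rewrite h' hg in hl.
  by move: hl; rewrite -lab' // h' hg.
have fc a : a < v -> f (c a) = g a.
  move=> ha; have /andP[_] := hp _ (c_lt ha); rewrite /allowed.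
  have -> : in_cover (c a) by apply/in_coverP; exists a.
  by move=> /allP /(_ a); rewrite mem_iota eqxx => /(_ ha) /eqP ->.
have fc' a : a < v -> f' (c a) = g a.
  by move=> ha; apply/eqP; rewrite eqg ?c_lt // fc.
exists f'; split=> // [i hi|l hl].
  case: (boolP (in_cover i)) => hc.
    case/in_coverP: hc => b hbv <-; rewrite fc' //.
    have := hb b; rewrite mem_iota => /(_ hbv) /andP[]; rewrite dig_sum_weight //; last lia.
    have -> : \sum_(0 <= j < n) contrib g j (f j) b =
        \sum_(0 <= j < n) (if f' j == g b then uv (c b) (id j) else U).
      apply: eq_big_nat => j /andP[_ hj]; by rewrite /contrib hbv eq_sym -eqg.
    have := sum_uv (fun j => f' j == g b) (c_lt hbv) (fun j hj => hj : id j < n).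
    by move=> /= h3 h4 _; lia.
  have := utility_off_cover hi hc fc'.
  suff : v * U <= \sum_(0 <= b < v) (if g b == f' i then uv i (c b) else U) by lia.
  case: (boolP (in_lab g (f i))) => hl.
    have /andP[_] := hp i hi; rewrite /allowed (negbTE hc) => /leq_trans; apply.
    by rewrite /f' hl.
  (* With no cover vertex in its new coalition, the agent has utility 0: every summand is the bare
     shift [U]. *)
  rewrite -[v in v * _]subn0 -sum_nat_const_nat !big_nat; apply: leq_sum => b /andP[_ hbv].
  case: eqP => // h'; move: hl; rewrite -lab' // -h'.
  by case/in_labP; exists b.
case: (boolP (in_lab g l)) => [/in_labP[b hbv <-]|hnl].
  have := hb b; rewrite mem_iota => /(_ hbv) /andP[_]; rewrite dig_sum_weight //; last lia.
  rewrite sum_size // => h3.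
  by rewrite (@eq_big_nat _ _ _ _ _ _ (fun j => nat_of_bool (f j == g b))) //
    => j /andP[_ hj]; rewrite eqg.
have := hh2 l hl hnl.
have -> // : \sum_(0 <= j < n) (~~ in_lab g (f j) && (h j == l)) =
  \sum_(0 <= j < n) (f' j == l).
apply: eq_big_nat => j /andP[_ hj]; rewrite /f'; case: ifP => //= hlj.
by case: eqP => // h'; rewrite h' (negbTE hnl) in hlj.
Qed.

End Core.

(** * Correctness of the algorithm *)

Lemma eq_has_iota n (P Q : pred nat) : (forall i, i < n -> P i = Q i) ->
  has P (iota 0 n) = has Q (iota 0 n).
Proof. by move=> h; apply: eq_in_has => i; rewrite mem_iota => /andP[_]; apply: h. Qed.

Lemma eq_all_iota n (P Q : pred nat) : (forall i, i < n -> P i = Q i) ->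
  all P (iota 0 n) = all Q (iota 0 n).
Proof. by move=> h; apply: eq_in_all => i; rewrite mem_iota => /andP[_]; apply: h. Qed.

Lemma existsBE B n (P Q : pred nat) : n <= B -> (forall i, i < n -> P i = Q i) ->
  existsB B n P = has Q (iota 0 n).
Proof. by move=> nB h; rewrite /existsB (minn_idPl nB); apply: eq_has_iota. Qed.

Lemma forallBE B n (P Q : pred nat) : n <= B -> (forall i, i < n -> P i = Q i) ->
  forallB B n P = all Q (iota 0 n).
Proof. by move=> nB h; rewrite /forallB (minn_idPl nB); apply: eq_all_iota. Qed.

Lemma addB_id B a b : b <= B -> addB B a b = a + b.
Proof. by move=> h; rewrite addBE (minn_idPl h). Qed.

Lemma mulB_id B a b : a <= B -> b <= B -> mulB B a b = a * b.
Proof. by move=> h1 h2; rewrite mulBE !(minn_idPl _). Qed.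

Lemma subB_id B a b : a <= B -> subB B a b = a - b.
Proof. by move=> h; rewrite subBE (minn_idPl h). Qed.

Lemma nth_table (f : nat -> seq bool -> bool) m q : q < m ->
  nth false (iteri m (fun i T => rcons T (f i T)) [::]) q =
  f q (iteri q (fun i T => rcons T (f i T)) [::]).
Proof.
have sz k : size (iteri k (fun i T => rcons T (f i T)) [::]) = k.
  by elim: k => //= k IH; rewrite size_rcons IH.
elim: m => // m IH; rewrite ltnS leq_eqVlt /= nth_rcons sz => /orP[/eqP->|h].
  by rewrite ltnn eqxx.
by rewrite h IH.
Qed.

Section Correct.

Variables lbB ubB : seq sym -> nat -> nat -> nat.
Variables (x : seq sym) (B n k : nat) (V : nat -> nat -> int) (lb ub : nat -> nat).

Let N := size x.
Let beta := N.+2 ^ 3.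

Hypothesis xB : N < B.
Hypothesis hn : nB x B = n.
Hypothesis hk : kB x B = k.
Hypothesis nN : n <= N.
Hypothesis nnN : n * n <= N.
Hypothesis kN : k <= N.
Hypothesis hmag : forall i j, i < n -> j < n -> onesB x B (i * n + j).+2 = `|V i j|%N.
Hypothesis hneg : forall i j, i < n -> j < n -> negB x B (i * n + j).+2 = (V i j < 0)%R.
Hypothesis VN : forall i j, i < n -> j < n -> `|V i j|%N <= N.
Hypothesis hlb : forall l, l < k -> lbB x B l = minn (lb l) B.
Hypothesis hub : forall l, l < k -> ubB x B l = minn (ub l) B.
Hypothesis lbub : forall l, lb l <= ub l.

(** The exponent is itself the outcome of capped arithmetic. It is exact: had a cap been active, the
    exponent would be so large that the power could not lie below [B]. *)
Lemma enough_pow v : v < B -> enoughB x B v -> beta ^ (v + v + 3) < B.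
Proof.
rewrite /enoughB /bpowB lenBE // !addBE mulBE => vB /powB_lt -/(_ isT).
rewrite (minn_idPl (ltnW vB)); set e := _ * _ => h.
have B3 : 2 < B.
  apply: leq_ltn_trans h; apply: (@leq_trans (N.+2 ^ 1)); first by rewrite expn1.
  by rewrite leq_exp2l // /e muln_gt0 !leq_min; lia.
have eE : e = 3 * (v + v + 3).
  rewrite /e !(minn_idPl B3) (minn_idPl _) //; rewrite leqNgt; apply/negP => hlt.
  have : B < B; last by rewrite ltnn.
  apply: leq_ltn_trans h; rewrite /e (minn_idPl B3) (minn_idPr (ltnW hlt)).
  by apply: ltnW; apply: (leq_ltn_trans (leq_pmull B (_ : 0 < 3))) => //; apply: ltn_expl.
by rewrite /beta -expnM -eE.
Qed.

Lemma beta_ge8 : 7 < beta.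
Proof. by rewrite /beta (@leq_exp2r 2 N.+2 3). Qed.

Lemma beta_gtN : n * (N + N).+1 < beta.
Proof.
rewrite /beta expnS expnS expn1; apply: (@leq_ltn_trans (N * (N + N).+1)).
  by rewrite leq_mul2r nN orbT.
nia.
Qed.

Lemma NNB : N + N + 1 < beta.
Proof. rewrite /beta !expnS expn0; nia. Qed.

Section FixedCover.

Variable v : nat.
Hypothesis hv : beta ^ (v + v + 3) < B.

Lemma bpow_lt e : e <= v + v + 3 -> beta ^ e < B.
Proof. by move=> he; apply: leq_ltn_trans hv; rewrite leq_exp2l //; have := beta_ge8; lia. Qed.

Lemma exp_lt e : e <= v + v + 3 -> e < B.
Proof.
by move=> he; apply: leq_ltn_trans (bpow_lt he); apply: ltnW; apply: ltn_expl; have := beta_ge8; lia.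
Qed.

Lemma v3B : v + v + 3 < B.
Proof. exact: exp_lt. Qed.

Lemma bpowBE e : e <= v + v + 3 -> bpowB x B e = beta ^ e.
Proof.
move=> he; rewrite /bpowB lenBE // mulB_id ?(ltnW (exp_lt he)) //; last by have := v3B; lia.
by rewrite powBE // expnM // (bpow_lt he).
Qed.

Lemma digBE s a : s <= B -> a <= v + v + 3 -> digB x B s a = dig beta s a.
Proof.
move=> hs ha; have b8 := beta_ge8.
have := bpow_lt ha; have : beta ^ 1 < B by apply: bpow_lt; lia.
rewrite /digB !bpowBE //; last lia.
rewrite expn1 => h1 h2; rewrite divBE //; last by rewrite expn_gt0 ltnW // ltnW.
rewrite modBE //; last by rewrite (ltnW h1) andbT; lia.
exact: leq_trans (leq_div _ _) hs.
Qed.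

Lemma beta_leB : beta < B.
Proof. by rewrite -[beta]expn1; apply: bpow_lt; lia. Qed.

Lemma n_leB : n <= B. Proof. lia. Qed.
Lemma v_leB : v <= B. Proof. by have := v3B; lia. Qed.

Lemma field_index i j : i < n -> j < n ->
  (addB B (mulB B i (nB x B)) j).+2 = (i * n + j).+2.
Proof. by move=> hi hj; rewrite hn addB_id ?mulB_id //; lia. Qed.

Lemma magBE i j : i < n -> j < n -> magB x B i j = `|V i j|%N.
Proof. by move=> hi hj; rewrite /magB field_index // hmag. Qed.

Lemma uvBE i j : i < n -> j < n -> uvB x B i j = uv N V i j.
Proof.
move=> hi hj; have := VN hi hj; rewrite /uvB /isnegB field_index // hneg // magBE // lenBE // /uv.
by move=> h; rewrite subB_id ?addB_id //; lia.
Qed.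

Section Codes.

Variable C : nat.
Hypothesis CB : C <= B.

Let c := dig beta C.

Lemma coverBP : reflect
  [/\ forall a, a < v -> c a < n,
      forall a b, a < v -> b < v -> c a = c b -> a = b &
      forall i j, i < n -> j < n -> V i j <> 0%R ->
        exists2 a, a < v & (c a == i) || (c a == j)]
  (coverB x B v C).
Proof.
have nB' := n_leB; have vB' := v_leB.
have cE a : a < v -> digB x B C a = c a by move=> ha; rewrite digBE //; lia.
rewrite /coverB hn; apply: (iffP and3P) => -[h1 h2 h3]; split.
- by move=> a ha; move/(forallBP _ vB'): h2 => /(_ a ha); rewrite cE.
- move=> a b ha hb h; move/(forallBP _ vB'): h3 => /(_ a ha) /(forallBP _ vB') /(_ b hb).
  by rewrite !cE // h eqxx => /eqP.
- move=> i j hi hj h; move/(forallBP _ nB'): h1 => /(_ i hi) /(forallBP _ nB') /(_ j hj).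
  rewrite magBE // absz_eq0; case: eqP => //= _ /(existsBP _ vB') [a ha].
  by rewrite cE //; exists a.
- apply/(forallBP _ nB') => i hi; apply/(forallBP _ nB') => j hj.
  rewrite magBE // absz_eq0; apply/implyP => /eqP /(h3 i j hi hj) [a ha h].
  by apply/(existsBP _ vB'); exists a; rewrite ?cE.
- by apply/(forallBP _ vB') => a ha; rewrite cE // h1.
- apply/(forallBP _ vB') => a ha; apply/(forallBP _ vB') => b hb.
  by rewrite !cE //; apply/implyP => /eqP /h2 ->.
Qed.

Lemma digC a : a < v -> digB x B C a = c a.
Proof. by move=> ha; rewrite digBE //; lia. Qed.

Variable L : nat.
Hypothesis LB : L <= B.

Let g := dig beta L.

Lemma digL a : a < v -> digB x B L a = g a.
Proof. by move=> ha; rewrite digBE //; lia. Qed.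

Lemma inlabBE l : inlabB x B v L l = in_lab v g l.
Proof. by rewrite /inlabB; apply: existsBE => [|a ha]; [exact: v_leB|rewrite digL]. Qed.

Hypothesis c_lt : forall a, a < v -> c a < n.
Hypothesis c_inj : forall a b, a < v -> b < v -> c a = c b -> a = b.
Hypothesis c_cover : forall i j, i < n -> j < n -> V i j <> 0%R ->
  exists2 a, a < v & (c a == i) || (c a == j).

Lemma uv_leB i j : i < n -> j < n -> uv N V i j <= N + N.
Proof. by move=> hi hj; exact: (uv_le VN beta_gtN hi hj). Qed.

Lemma allowedBE i l : i < n -> allowedB x B v C L i l = allowed v N V c g i l.
Proof.
move=> hi; rewrite /allowedB /allowed /in_cover; have vB' := v_leB.
rewrite (existsBE (Q := fun a => c a == i)) // => [|a ha]; last by rewrite digC.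
case: ifP => _; first by apply: forallBE => // a ha; rewrite digC // digL.
have bB := beta_leB; have nnb := NNB.
rewrite lenBE // mulB_id // ?(ltnW xB) // sumBE //; last first.
  move=> b hb; rewrite digL // digC // uvBE ?c_lt //.
  by have := uv_leB hi (c_lt hb); case: ifP; lia.
congr (_ <= _); rewrite !big_nat; apply: eq_bigr => b /andP[_ hb].
by rewrite digL // digC // uvBE ?c_lt.
Qed.

Lemma contribBE i l e : i < n -> e < (v + v).+1 ->
  contribB x B v C L i l e = contrib v N V c g i l e.
Proof.
move=> hi he; rewrite /contribB /contrib addB_id ?v_leB //.
case: ifP => hev; first by rewrite digL // digC // uvBE ?c_lt // lenBE.
rewrite inlabBE; case: ifP => hev' //; rewrite subB_id; last by have := v3B; lia.
by rewrite digL //; lia.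
Qed.

Lemma weightBE i l : i < n -> l < k -> weightB x B v C L i l = weight v N beta V c g i l.
Proof.
move=> hi hl; rewrite /weightB addB_id ?v_leB //; have v3B := v3B; have bB := beta_leB.
have nnb := NNB.
have cl e : e < (v + v).+1 -> contrib v N V c g i l e <= N + N + 1.
  by move=> he; apply: (contrib_lt (k := k) VN beta_gtN c_lt).
rewrite sumBE; [|lia|]; last first.
  move=> e he; rewrite contribBE // bpowBE; last lia.
  have := cl e he => cle; rewrite mulB_id; [|lia|by apply: ltnW; apply: bpow_lt; lia].
  apply: (@leq_trans (beta * beta ^ e)); first by rewrite leq_mul2r; lia.
  by rewrite -expnS; apply: ltnW; apply: bpow_lt; lia.
rewrite /weight /of_digits !big_nat; apply: eq_bigr => e /andP[_ he].
rewrite contribBE // bpowBE; last lia.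
by rewrite mulB_id //; [have := cl e he; lia|apply: ltnW; apply: bpow_lt; lia].
Qed.

Let S := beta ^ (v + v).+1.

Lemma blockBE : blockB x B v = S.
Proof. by rewrite /blockB addB_id ?v_leB // bpowBE //; lia. Qed.

Lemma S_gt0 : 0 < S.
Proof. by rewrite expn_gt0; have := beta_ge8; lia. Qed.

Lemma nSB : n.+1 * S <= B.
Proof.
apply: (@leq_trans (beta * S)).
  by rewrite leq_mul2r; have := NNB; lia.
by rewrite -expnS; apply: ltnW; apply: bpow_lt; lia.
Qed.

Let wt := weight v N beta V c g.
Let pth := admissible k v N V c g.

Lemma tableP i s : i <= n -> s < S ->
  reflect (exists2 f, pth i f & \sum_(0 <= j < i) wt j (f j) = s)
          (nth false (tableB x B v C L) (i * S + s)).
Proof.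
have S0 := S_gt0; have nSB := nSB.
have SB : S <= B by apply: leq_trans nSB; rewrite mulSn leq_addr.
have inB i' s' : i' <= n -> s' < S -> i' * S + s' < n.+1 * S.
  move=> hi hs; apply: (@leq_trans (i'.+1 * S)); first by rewrite mulSn; lia.
  by rewrite leq_mul2r; lia.
(* The rule for entry [q] sees only the entries before it. Entries are never changed afterwards, so
   lookups in this prefix agree with the finished table. *)
have TE m q : q < m -> q < n.+1 * S ->
    nth false (iteri m (fun i T => rcons T (ruleB x B v C L i T)) [::]) q =
    nth false (tableB x B v C L) q.
  move=> hm hq; rewrite /tableB /table /loop hn blockBE mulB_id; [|lia|lia].
  by rewrite (minn_idPl nSB) !nth_table.
have RE q : q < n.+1 * S -> nth false (tableB x B v C L) q =
    ruleB x B v C L q (iteri q (fun i T => rcons T (ruleB x B v C L i T)) [::]).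
  by move=> hq; rewrite -(TE _ q (leqnn q.+1)) // nth_table.
elim: i s => [|i IH] s hi hs.
  rewrite RE ?inB // /ruleB blockBE mul0n add0n hs.
  apply: (iffP eqP) => [->|[f _ <-]]; last by rewrite big_nil.
  by exists id; rewrite ?big_nil.
have hB := inB i.+1 s hi hs.
rewrite RE //; set T0 := iteri _ _ _; rewrite /ruleB blockBE.
have -> : (i.+1 * S + s < S) = false by rewrite mulSn; lia.
have dE : divB B (i.+1 * S + s) S = i.+1.
  by rewrite divBE; [rewrite divnMDl // divn_small ?addn0|lia|lia].
have mE : modB B (i.+1 * S + s) S = s.
  by rewrite modBE; [rewrite modnMDl modn_small|lia|lia].
have iE : subB B i.+1 1 = i by rewrite subB_id; lia.
have pE : subB B (i.+1 * S + s) S = i * S + s by rewrite subB_id ?mulSn; lia.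
rewrite dE mE iE pE hk.
have body l : l < k -> allowedB x B v C L i l && ((weightB x B v C L i l <= s) &&
     nth false T0 (subB B (i * S + s) (weightB x B v C L i l))) =
    allowed v N V c g i l && ((wt i l <= s) && nth false (tableB x B v C L) (i * S + (s - wt i l))).
  move=> hl; rewrite allowedBE // weightBE // -/(wt i l).
  case: (leqP (wt i l) s) => hw; rewrite ?andbF //.
  rewrite subB_id; last by have := inB i s (ltnW hi) hs; lia.
  by rewrite -addnBA // /T0 TE ?mulSn; [|lia|apply: leq_trans (inB i s (ltnW hi) hs); lia].
have kB' : k <= B by lia.
rewrite (existsBE kB' body); apply: (iffP hasP) => [[l]|[f hf hs']].
  rewrite mem_iota add0n => /andP[_ hl] /and3P[hal hw] /IH [||f hf hs'] //; [exact: ltnW|lia|].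
  exists (fun j => if j == i then l else f j).
    move=> j; rewrite ltnS leq_eqVlt => /orP[/eqP->|hj]; first by rewrite eqxx hl.
    by rewrite ltn_eqF //; apply: hf.
  rewrite big_nat_recr //= eqxx.
  have -> : \sum_(0 <= j < i) wt j (if j == i then l else f j) = s - wt i l.
    by rewrite -hs'; apply: eq_big_nat => j /andP[_ hj]; rewrite ltn_eqF.
  lia.
have /andP[hfk hfa] := hf i (leqnn _).
move: hs'; rewrite big_nat_recr //= => hs'.
exists (f i); rewrite ?mem_iota // hfa /=; apply/andP; split; first by rewrite -hs' leq_addl.
apply/IH; [exact: ltnW|lia|]; exists f; last by rewrite -hs' addnK.
by move=> j hj; apply: hf; lia.
Qed.

(** The size bounds are read only up to [B], but they and their sums are compared with digits, which
    are below [B]; cutting at [B] changes no comparison. *)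
Lemma finalBE s : s < S -> (forall a, a < v -> g a < k) ->
  finalB lbB ubB x B v L s = final n k v N beta lb ub g s.
Proof.
move=> hs hg; rewrite /finalB /final hn hk lenBE //.
have S0 := S_gt0; have nSB := nSB; have bB := beta_leB; have v3B := v3B; have b8 := beta_ge8.
have SB : S <= B by apply: leq_trans nSB; rewrite mulSn leq_addr.
have dB a : dig beta s a < B by apply: ltn_trans bB; rewrite ltn_mod; lia.
congr (_ && _).
  apply: forallBE => [|b hb]; first exact: v_leB.
  rewrite addB_id; last lia.
  rewrite !digBE; [|lia..].
  rewrite -/(g b) hlb ?hg // hub ?hg // mulB_id ?(ltnW xB) //; last lia.
  have := dB (v + b); set d := dig _ _ _ => hd.
  by congr (_ && _); rewrite leq_min geq_min (leqNgt B) hd orbF (ltnW hd) andbT.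
rewrite addB_id; last lia.
rewrite digBE; [|lia..].
have := dB (v + v); set d := dig _ _ _ => hd.
rewrite sumBE; [|lia|by move=> l hl; case: ifP => // _; rewrite hlb // geq_minr].
rewrite sumBE; [|lia|by move=> l hl; case: ifP => // _; rewrite hub // geq_minr].
have clip F F' : (forall l, l < k -> F' l = minn (F l) B) ->
    minn (\sum_(0 <= l < k) (if inlabB x B v L l then 0 else F' l)) B =
    minn (\sum_(0 <= l < k) (if in_lab v g l then 0 else F l)) B.
  elim: (k) => [|m IH] h; first by rewrite !big_nil.
  rewrite !big_nat_recr //= inlabBE; have := IH (fun l hl => h l (ltnW hl)).
  by rewrite h //; case: ifP => _; lia.
by have := clip lb _ hlb; have := clip ub _ hub; lia.
Qed.

Lemma admissible_labels f : pth n f -> forall a, a < v -> g a < k.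
Proof.
move=> hf a ha; have /andP[hfk] := hf _ (c_lt ha); rewrite /allowed.
have -> : in_cover v c (c a) by apply/in_coverP; exists a.
by move=> /allP /(_ a); rewrite mem_iota eqxx => /(_ ha) /eqP ->.
Qed.

Lemma reachBP : reflect
  (exists2 f, pth n f & final n k v N beta lb ub g (\sum_(0 <= j < n) wt j (f j)))
  (reachB lbB ubB x B v L (tableB x B v C L)).
Proof.
rewrite /reachB blockBE hn.
have S0 := S_gt0; have nSB := nSB.
have SB : S <= B by apply: leq_trans nSB; rewrite mulSn leq_addr.
have iE s : s < S -> addB B (mulB B n S) s = n * S + s.
  by move=> hs; rewrite addB_id ?mulB_id //; lia.
apply: (iffP (existsBP _ SB)) => [[s hs]|[f hf hfin]].
  rewrite iE // => /andP[/tableP -/(_ (leqnn n) hs) [f hf sE]].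
  by rewrite finalBE //; [exists f; rewrite ?sE|exact: admissible_labels hf].
have hs : \sum_(0 <= j < n) wt j (f j) < S.
  by apply: (sum_weight_lt (k := k) VN beta_gtN c_lt) => // j /hf /andP[].
by exists (\sum_(0 <= j < n) wt j (f j)) => //; rewrite iE // finalBE ?hfin ?andbT //;
  [apply/tableP => //; exists f|exact: admissible_labels hf].
Qed.

End Codes.

End FixedCover.

Lemma of_digits_code v d : beta ^ (v + v + 3) < B -> (forall a, a < v -> d a < beta) ->
  [/\ of_digits beta v d < bpowB x B v, of_digits beta v d <= B &
      forall a, a < v -> dig beta (of_digits beta v d) a = d a].
Proof.
move=> hv hd; have lt := of_digits_lt hd; have vv : v <= v + v + 3 by lia.
rewrite (bpowBE hv) //; split=> // [|a ha]; last exact: dig_of_digits.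
by apply: ltnW; apply: ltn_trans lt _; apply: bpow_lt hv _ _.
Qed.

(** A positive answer is sound for whichever cover produced it, and a solution is found with the
    cover that certified [B]. The verdict is therefore right at any [B] where the search stops,
    before or after a minimum cover fits. *)
Theorem result_correct : 0 < resultB lbB ubB x B ->
  (1 < resultB lbB ubB x B <-> exists f, valid n k V lb ub f).
Proof.
rewrite /resultB lenBE // xB hk kN.
case: ifP => // /(existsBP _ (leqnn B)) [v1 v1B /andP[/(enough_pow v1B) hv1]].
have vle v : v <= v + v + 3 by lia.
have bB v : beta ^ (v + v + 3) < B -> bpowB x B v <= B.
  by move=> hv; rewrite (bpowBE hv) // ltnW // (bpow_lt hv).
case/(existsBP _ (bB _ hv1)) => C1 C1lt hC1 _.
have C1B : C1 <= B by apply: ltnW; apply: leq_trans C1lt (bB _ hv1).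
set E := existsB _ _ _; have -> : (1 < if E then 2 else 1) = E by case: E.
split.
  case/(existsBP _ (leqnn B)) => v vB /andP[/(enough_pow vB) hv] /(existsBP _ (bB _ hv)) [C Clt /andP[hC]].
  have CB : C <= B by apply: ltnW; apply: leq_trans Clt (bB _ hv).
  case/(existsBP _ (bB _ hv)) => L Llt.
  have LB : L <= B by apply: ltnW; apply: leq_trans Llt (bB _ hv).
  have /(coverBP hv CB) [c_lt c_inj c_cover] := hC.
  case/(reachBP hv CB LB c_lt) => f hf hfin.
  exact: (admissible_valid VN lbub beta_gtN c_lt c_inj c_cover hf hfin).
case=> f hf; apply/(existsBP _ (leqnn B)); exists v1 => //; apply/andP; split.
  rewrite /enoughB; have v3 := v3B hv1.
  by rewrite !addB_id ?(bpowBE hv1) //; lia.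
apply/(existsBP _ (bB _ hv1)); exists C1 => //; rewrite hC1 /=.
have /(coverBP hv1 C1B) [c_lt c_inj c_cover] := hC1.
(* The successful guess is the solution restricted to the cover; its labels are digits because
   [k <= N < beta]. *)
pose d a := f (dig beta C1 a).
have fk j : j < n -> f j < k by case: hf => h _ _; apply: h.
have [|Llt LB dL] := of_digits_code (d := d) hv1.
  by move=> a ha; have := fk _ (c_lt a ha); have := NNB; rewrite /d; lia.
apply/(existsBP _ (bB _ hv1)); exists (of_digits beta v1 d) => //.
apply/(reachBP hv1 C1B LB c_lt); exists f.
  by have [] := valid_admissible VN beta_gtN c_lt c_inj c_cover hf (fun a ha => esym (dL a ha)).
by have [] := valid_admissible VN beta_gtN c_lt c_inj c_cover hf (fun a ha => esym (dL a ha)).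
Qed.

Theorem result_halts v (c : nat -> nat) : beta ^ (v + v + 3) < B ->
  (forall a, a < v -> c a < n) -> (forall a b, a < v -> b < v -> c a = c b -> a = b) ->
  (forall i j, i < n -> j < n -> V i j <> 0%R -> exists2 a, a < v & (c a == i) || (c a == j)) ->
  0 < resultB lbB ubB x B.
Proof.
move=> hv c_lt c_inj c_cover; rewrite /resultB lenBE // xB hk kN.
suff -> : existsB B B (fun v => enoughB x B v &&
    existsB B (bpowB x B v) (fun C => coverB x B v C)) by case: ifP.
have v3 := v3B hv.
have vB : v < B by lia.
have vv : v <= v + v + 3 by lia.
have bB : bpowB x B v <= B by rewrite (bpowBE hv vv) ltnW // (bpow_lt hv vv).
apply/(existsBP _ (leqnn B)); exists v => //; apply/andP; split.
  by rewrite /enoughB !addB_id ?(bpowBE hv) //; lia.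
have [|Clt CB dC] := of_digits_code (d := c) hv.
  by move=> a ha; have := c_lt a ha; have := NNB; lia.
apply/(existsBP _ bB); exists (of_digits beta v c) => //.
apply/(coverBP hv CB); split=> [a ha|a b ha hb|i j hi hj h].
- by rewrite dC // c_lt.
- by rewrite !dC //; apply: c_inj.
- by have [a ha h'] := c_cover i j hi hj h; exists a; rewrite ?dC.
Qed.

End Correct.

(** * Encodings of games *)

Definition nat_val n (v : valuation n) (i j : nat) : int :=
  if (insub i, insub j) is (Some i', Some j') then v i' j' else 0%R.

Lemma nat_valE n (v : valuation n) (i j : 'I_n) : nat_val v i j = v i j.
Proof. by rewrite /nat_val !valK. Qed.

Definition nat_fun k (h : 'I_k -> nat) (l : nat) : nat := if insub l is Some l' then h l' else 0.

Lemma nat_funE k (h : 'I_k -> nat) (l : 'I_k) : nat_fun h l = h l.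
Proof. by rewrite /nat_fun valK. Qed.

Section Labelling.

Variables (n k : nat) (v : valuation n) (F : 'I_n -> 'I_k) (f : nat -> nat).
Hypothesis fF : forall i : 'I_n, f i = F i.

Lemma utility_nat (i : 'I_n) :
  utility v F i = (\sum_(0 <= j < n | f j == f i) nat_val v i j)%R.
Proof.
rewrite /utility big_mkord; apply: eq_big => [j|j _]; last by rewrite nat_valE.
by rewrite !fF.
Qed.

Lemma card_nat (l : 'I_k) : #|[set i | F i == l]| = \sum_(0 <= j < n) (f j == l).
Proof.
rewrite cardsE -sum1_card big_mkcond big_mkord; apply: eq_bigr => j _.
have -> : (f j == l) = (F j == l) by rewrite fF.
by rewrite unfold_in -[eqn _ _]/(F j == l); case: (F j == l).
Qed.

End Labelling.

Lemma SCC_valid n k (v : valuation n) (lb ub : 'I_k -> nat) :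
  SCC_has_IR v lb ub <->
  exists f, valid n k (nat_val v) (nat_fun lb) (nat_fun ub) f.
Proof.
split=> [[F [hs hu]]|[f [hk hu hs]]].
  pose f := nat_fun (fun j => F j : nat).
  have fF i : f (nat_of_ord i) = F i by apply: nat_funE.
  exists f; split=> [j hj|i hi|l hl].
  - by rewrite (fF (Ordinal hj)).
  - by have := hu (Ordinal hi); rewrite (utility_nat v fF).
  - by have := hs (Ordinal hl); rewrite (card_nat fF) -(nat_funE lb) -(nat_funE ub).
pose F i : 'I_k := Ordinal (hk _ (ltn_ord (i : 'I_n))).
have fF (i : 'I_n) : f i = F i by [].
exists F; split=> [l|i].
  by rewrite (card_nat fF) -(nat_funE lb) -(nat_funE ub) hs.
by rewrite (utility_nat v fF); apply: hu.
Qed.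

(** Nonemptiness is the lower bound 1. The upper bound is [n.+1] rather than [n], so that it is not
    below 1 when there are no agents. *)
Lemma kASHG_SCC n k (v : valuation n) :
  kASHG_has_IR k v <-> SCC_has_IR v (fun _ : 'I_k => 1) (fun=> n.+1).
Proof.
split=> -[F [hF hu]]; exists F; split=> // l.
  rewrite card_gt0; apply/andP; split.
    by have [i <-] := hF l; apply/set0Pn; exists i; rewrite inE.
  by apply: leqW; rewrite -[X in _ <= X]card_ord max_card.
have /andP[+ _] := hF l; rewrite card_gt0 => /set0Pn[i]; rewrite inE => /eqP.
by exists i.
Qed.

Lemma small_cover n (v : valuation n) : exists c : nat -> nat,
  [/\ forall a, a < vcn v -> c a < n,
      forall a b, a < vcn v -> b < vcn v -> c a = c b -> a = b &
      forall i j, i < n -> j < n -> nat_val v i j <> 0%R ->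
        exists2 a, a < vcn v & (c a == i) || (c a == j)].
Proof.
rewrite /vcn; case: ex_minnP => m /existsP[C /andP[hC /eqP <-]] _.
pose s := map val (enum C).
have sz : size s = #|C| by rewrite size_map -cardE.
have su : uniq s by rewrite map_inj_uniq ?enum_uniq //; apply: val_inj.
have memC (i : 'I_n) : i \in C -> exists2 a, a < #|C| & nth 0 s a = i.
  move=> iC; have : val i \in s by apply: map_f; rewrite mem_enum.
  by move=> his; exists (index (val i) s); rewrite ?nth_index // -sz index_mem.
exists (nth 0 s); split.
- move=> a; rewrite -sz => /(mem_nth 0) /mapP[i _ ->]; exact: ltn_ord.
- by move=> a b; rewrite -sz => ha hb /eqP; rewrite nth_uniq // => /eqP.
- move=> i j hi hj; rewrite (nat_valE v (Ordinal hi) (Ordinal hj)) => /eqP h.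
  have /forallP /(_ (Ordinal hi)) /forallP /(_ (Ordinal hj)) := hC.
  rewrite h /= => /orP[] /memC [a ha e]; exists a; rewrite // e eqxx ?orbT //.
Qed.

Definition val_words n (v : valuation n) : seq (seq sym) :=
  [seq int_word (v i j) | i <- enum 'I_n, j <- enum 'I_n].

(** The common shape of both encodings; [rest] is empty for a k-ASHG and lists the size bounds for
    an ASHG-SCC. *)
Definition game_words n k (v : valuation n) (rest : seq (seq sym)) :=
  [:: nseq n S1, bits k & val_words v ++ rest].

Lemma enc_valsE n (v : valuation n) : enc_vals v = join (val_words v).
Proof.
rewrite /enc_vals /join map_allpairs; congr flatten.
by apply: eq_allpairs => // i j; rewrite enc_intE.
Qed.

Lemma unaryE m : unary m = rcons (nseq m S1) Ssep.
Proof. by rewrite /unary cats1. Qed.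

Lemma enc_kASHGE I : enc_kASHG I = join (game_words (ka_k I) (ka_v I) [::]).
Proof. by rewrite /enc_kASHG enc_valsE /game_words cats0 /join /= -unaryE -binaryE. Qed.

Definition bound_words k (lb ub : 'I_k -> nat) : seq (seq sym) :=
  flatten [seq [:: bits (lb j); bits (ub j)] | j <- enum 'I_k].

Lemma enc_SCCE I : enc_SCC I =
  join (game_words (sc_k I) (sc_v I) (bound_words (sc_lb I) (sc_ub I))).
Proof.
rewrite /enc_SCC enc_valsE /game_words /join /= -unaryE -binaryE map_cat flatten_cat.
do 3 congr (_ ++ _); rewrite /bound_words; elim: (enum _) => //= j s ->.
by rewrite !binaryE catA.
Qed.

Lemma no_sep_val_words n (v : valuation n) : all no_sep (val_words v).
Proof.
by apply/all_allpairsP => i j _ _; apply: no_sep_int.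
Qed.

Lemma size_val_words n (v : valuation n) : size (val_words v) = n * n.
Proof. by rewrite size_allpairs size_enum_ord. Qed.

Lemma nth_val_words n (v : valuation n) (i j : 'I_n) :
  nth [::] (val_words v) (i * n + j) = int_word (v i j).
Proof.
rewrite /val_words nth_flatten_const //; last 2 first.
- by rewrite all_map; apply/allP => i' _ /=; rewrite size_map size_enum_ord.
- by rewrite size_map size_enum_ord.
by rewrite (nth_map i) ?size_enum_ord // (nth_map j) ?size_enum_ord // !nth_ord_enum.
Qed.

Lemma size_join ws : size ws <= size (join ws).
Proof. by elim: ws => //= w ws IH; rewrite /join /= size_cat size_rcons; move: IH; rewrite /join; lia. Qed.

Lemma words_le_size n k (v : valuation n) rest :
  n * n + size rest <= size (join (game_words k v rest)).
Proof.
apply: leq_trans (size_join _); rewrite /= size_cat size_val_words; lia.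
Qed.

Section Encoding.

Variables (n k : nat) (v : valuation n) (rest : seq (seq sym)) (B : nat).
Hypothesis hrest : all no_sep rest.
Let x := join (game_words k v rest).
Hypothesis xB : size x < B.

Lemma no_sep_game_words : all no_sep (game_words k v rest).
Proof. by rewrite /= no_sep_ones no_sep_bits all_cat no_sep_val_words. Qed.

Lemma nth_field_game f : f < size (game_words k v rest) ->
  nth_field x f = rcons (nth [::] (game_words k v rest) f) Ssep.
Proof. exact: field_join no_sep_game_words. Qed.

Lemma nB_game : nB x B = n.
Proof.
by rewrite /nB onesBE // nth_field_game // -cats1 count_cat addn0 count_nseq mul1n.
Qed.

Lemma kB_game : kB x B = minn k B.
Proof.
by rewrite /kB (binBE xB (w := bits k)) ?bits_le1 ?bin_value_bits // nth_field_game.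
Qed.

Lemma nth_field_val (i j : 'I_n) :
  nth_field x (i * n + j).+2 = rcons (int_word (v i j)) Ssep.
Proof.
have lt : i * n + j < n * n.
  by apply: (@leq_trans (i.+1 * n)); [rewrite mulSn; have := ltn_ord j; lia|rewrite leq_mul2r ltn_ord orbT].
rewrite nth_field_game /= ?size_cat ?size_val_words ?ltnS; last lia.
by rewrite nth_cat size_val_words lt nth_val_words.
Qed.

Lemma mag_game i j : i < n -> j < n -> onesB x B (i * n + j).+2 = `|nat_val v i j|%N.
Proof.
move=> hi hj; rewrite onesBE // (nth_field_val (Ordinal hi) (Ordinal hj)).
by rewrite count_ones_int (nat_valE v (Ordinal hi) (Ordinal hj)).
Qed.

Lemma neg_game i j : i < n -> j < n -> negB x B (i * n + j).+2 = (nat_val v i j < 0)%R.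
Proof.
move=> hi hj; rewrite negBE // (nth_field_val (Ordinal hi) (Ordinal hj)).
by rewrite has_neg_int (nat_valE v (Ordinal hi) (Ordinal hj)).
Qed.

Lemma onesB_le f : onesB x B f <= size x.
Proof.
rewrite /onesB countBE lenBE // (leq_trans (count_size _ _)) // size_iota.
exact: geq_minl.
Qed.

Lemma n_le_size : n <= size x.
Proof. by rewrite -[X in X <= _]nB_game onesB_le. Qed.

End Encoding.

(** * One decision procedure for both kinds of games *)

Lemma lenB_lt x B : lenB x B < B -> size x < B.
Proof.
rewrite ltnNge => h; rewrite ltnNge; apply: contra h => xB.
have : all (fun p => input x p != 4) (iota 0 B).
  apply/allP => p; rewrite mem_iota => /andP[_ hp].
  by rewrite input_nth; [case: (nth _ _ _)|exact: leq_trans hp xB].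
by rewrite all_count size_iota /lenB countBE minnn => /eqP ->.
Qed.

(** The left base is at most [4 * g ^ (6v + 9)], hence at most [g ^ (6v + 11)], and
    [6v + 11 <= 11 * (v + 1)]; this is the origin of 11. The successor of [v] absorbs the part of
    the exponent that remains for an empty cover. *)
Lemma exp_bound g v c : 1 < g ->
  (g ^ (3 * (v + v + 3)) + 1 + 2) ^ c <= g ^ (11 * c * v.+1).
Proof.
move=> g1; have -> : 11 * c * v.+1 = (11 * v.+1) * c by lia.
rewrite [leqRHS]expnM; apply: leq_expl.
apply: (@leq_trans (g ^ (3 * (v + v + 3)).+2)); last by rewrite leq_exp2l //; lia.
have a0 : 0 < g ^ (3 * (v + v + 3)) by rewrite expn_gt0 ltnW.
rewrite 2!expnS mulnA; apply: (@leq_trans (4 * g ^ (3 * (v + v + 3)))); first by lia.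
by rewrite leq_mul2r (leq_mul g1 g1) orbT.
Qed.

(** The two problems differ only in where the size bounds come from and in the reason why a solvable
    instance has [k] at most the input length although [k] is written in binary; both are
    parameters. *)
Theorem decide_games (lbB ubB : seq sym -> nat -> nat -> nat) (I : Type)
    (n k : I -> nat) (v : forall i, valuation (n i)) (rest : I -> seq (seq sym))
    (lb ub : I -> nat -> nat) (P : I -> Prop) :
  let x i := join (game_words (k i) (v i) (rest i)) in
  (forall F, computable F -> computable (fun x B T s => lbB x B (F x B T s))) ->
  (forall F, computable F -> computable (fun x B T s => ubB x B (F x B T s))) ->
  (forall i, all no_sep (rest i)) ->
  (forall i l, lb i l <= ub i l) ->
  (forall i B l, size (x i) < B -> l < k i -> lbB (x i) B l = minn (lb i l) B) ->
  (forall i B l, size (x i) < B -> l < k i -> ubB (x i) B l = minn (ub i l) B) ->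
  (forall i, P i <-> exists f, valid (n i) (k i) (nat_val (v i)) (lb i) (ub i) f) ->
  (forall i, P i -> k i <= size (x i)) ->
  exists (M : TM) (c : nat), tm_wf M /\
    forall i, exists t, t <= (size (x i)).+2 ^ (c * (vcn (v i)).+1) /\
      decides_within M (x i) t (P i).
Proof.
move=> x comp_lb comp_ub hrest lbub hlb hub PE Pk.
have [e he] := comp_result comp_lb comp_ub.
have [M [c [wfM hM]]] := expr_TM e.
exists M, (11 * c); split=> // i.
(* The least bound above [beta ^ (2 vc + 3)], at which a minimum vertex cover passes the
   certificate. *)
pose b := (size (x i)).+2 ^ (3 * (vcn (v i) + vcn (v i) + 3)) + 1.
have g1 : 1 < (size (x i)).+2 by [].
have xb : size (x i) < b.
  rewrite /b addn1 ltnS; apply: ltnW; apply: ltnW.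
  rewrite -{1}[(size (x i)).+2]expn1 leq_exp2l //; lia.
have kBE B : size (x i) < B -> k i <= size (x i) -> kB (x i) B = k i.
  by move=> xB hk; rewrite (kB_game (hrest i) xB); lia.
have VN B : size (x i) < B -> forall a a', a < n i -> a' < n i ->
    `|nat_val (v i) a a'|%N <= size (x i).
  by move=> xB a a' ha ha'; rewrite -(mag_game (hrest i) xB ha ha') onesB_le.
have nnN : n i * n i <= size (x i).
  by have := words_le_size (k i) (v i) (rest i); rewrite -/(x i); lia.
have hb : 0 < resultB lbB ubB (x i) b.
  case: (leqP (k i) (size (x i))) => hk; last first.
    rewrite /resultB lenBE // xb (kB_game (hrest i) xb).
    by have -> : (minn (k i) b <= size (x i)) = false by lia.
  have [cv [c1 c2 c3]] := small_cover (v i).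
  apply: (result_halts lbB ubB xb (nB_game (hrest i) xb) (kBE b xb hk)
    (n_le_size (hrest i) xb) nnN hk (mag_game (hrest i) xb) _ c1 c2 c3).
  by rewrite -expnM /b addn1.
have [t [B0 [ht hB0 hd]]] : exists t B0, [/\ t <= (b + 2) ^ c,
    0 < resultB lbB ubB (x i) B0 & decides_within M (x i) t (1 < resultB lbB ubB (x i) B0)].
  have [|t [B0 [h1 h2 h3]]] := hM (x i) b; first by rewrite he.
  by exists t, B0; rewrite he in h2 h3.
exists t; split; first by apply: leq_trans ht (exp_bound _ _ g1).
apply: decides_within_iff hd.
have xB0 : size (x i) < B0.
  by apply: lenB_lt; move: hB0; rewrite /resultB; case: ifP.
(* A number of coalitions beyond the input length is answered negatively at once, and [Pk] says that
   this is right. *)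
case: (leqP (k i) (size (x i))) => hk; last first.
  rewrite /resultB lenBE // xB0 (kB_game (hrest i) xB0).
  have -> : (minn (k i) B0 <= size (x i)) = false by lia.
  by split=> // /Pk; lia.
rewrite PE; exact: (result_correct xB0 (nB_game (hrest i) xB0) (kBE B0 xB0 hk)
  (n_le_size (hrest i) xB0) nnN hk (mag_game (hrest i) xB0) (neg_game (hrest i) xB0)
  (VN B0 xB0) (fun l => hlb i B0 l xB0) (fun l => hub i B0 l xB0) (lbub i) hB0).
Qed.

(** After the two leading fields and the [n * n] values, lower and upper bounds alternate: [c = 2]
    addresses the former and [c = 3] the latter. *)
Definition bound_fieldB (c : nat) x B l :=
  binB x B (c + addB B (mulB B (nB x B) (nB x B)) (addB B l l)).

Lemma comp_bound_field c F : computable F ->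
  computable (fun x B T s => bound_fieldB c x B (F x B T s)).
Proof.
move=> hF; rewrite /bound_fieldB; apply: comp_bin.
have H : computable (fun x B T s =>
    addB B (mulB B (nB x B) (nB x B)) (addB B (F x B T s) (F x B T s))).
  by rewrite /nB; comp_tac.
by elim: c => [|c IH]; [exact: H|exact: comp_succ IH].
Qed.

Lemma no_sep_bound_words k (lb ub : 'I_k -> nat) : all no_sep (bound_words lb ub).
Proof.
by rewrite /bound_words; elim: (enum _) => //= j s ->; rewrite !no_sep_bits.
Qed.

Lemma size_bound_words k (lb ub : 'I_k -> nat) : size (bound_words lb ub) = k * 2.
Proof.
rewrite /bound_words (@size_flatten_const _ _ 2); last by rewrite all_map; apply/allP.
by rewrite size_map size_enum_ord.
Qed.

Lemma nth_bound_words k (lb ub : 'I_k -> nat) (l : 'I_k) c : c < 2 ->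
  nth [::] (bound_words lb ub) (l * 2 + c) = bits ((if c == 0 then lb else ub) l).
Proof.
move=> hc; rewrite /bound_words nth_flatten_const //; last 2 first.
- by rewrite all_map; apply/allP.
- by rewrite size_map size_enum_ord.
rewrite (nth_map l) ?size_enum_ord // nth_ord_enum.
by case: c hc => [|[]].
Qed.

Lemma bound_fieldBE n k (v : valuation n) (lb ub : 'I_k -> nat) B c l :
  let x := join (game_words k v (bound_words lb ub)) in
  size x < B -> c < 2 -> l < k ->
  bound_fieldB c.+2 x B l = minn (nat_fun (if c == 0 then lb else ub) l) B.
Proof.
move=> x xB hc hl; have hr := no_sep_bound_words lb ub.
have := words_le_size k v (bound_words lb ub); rewrite size_bound_words -/x => hs.
have nx : n <= size x := n_le_size hr xB.
have e1 : addB B l l = l + l by rewrite addB_id //; lia.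
have e2 : mulB B n n = n * n by rewrite mulB_id //; lia.
rewrite /bound_fieldB (nB_game hr xB) e1 e2 addB_id; last lia.
rewrite (binBE xB (w := bits ((if c == 0 then lb else ub) (Ordinal hl)))).
- by rewrite bin_value_bits (nat_funE _ (Ordinal hl)).
- rewrite nth_field_game //; last first.
    by rewrite /= size_cat size_val_words size_bound_words; lia.
  have -> : c.+2 + (n * n + (l + l)) = (n * n + (l * 2 + c)).+2 by lia.
  rewrite /= nth_cat size_val_words ltnNge leq_addr /= addKn.
  by rewrite (nth_bound_words _ _ (Ordinal hl)).
- exact: bits_le1.
Qed.

Theorem mainTheorem4 :
  (exists (M : TM) (c : nat), tm_wf M /\
     forall I : kASHG,
       exists t, leq t ((size (enc_kASHG I)).+2 ^ (c * (vcn (ka_v I)).+1)) /\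
         decides_within M (enc_kASHG I) t
           (kASHG_has_IR (ka_k I) (ka_v I))) /\
  (exists (M : TM) (c : nat), tm_wf M /\
     forall I : ASHG_SCC,
       exists t, leq t ((size (enc_SCC I)).+2 ^ (c * (vcn (sc_v I)).+1)) /\
         decides_within M (enc_SCC I) t
           (SCC_has_IR (sc_v I) (sc_lb I) (sc_ub I))).
Proof.
split.
  have [F _|F _|//|I l|I B l xB hl|I B l xB hl|I|I [F [hF _]]|M [c [wfM hM]]] :=
    @decide_games (fun _ _ _ => 1) (fun x B _ => (nB x B).+1)
    kASHG ka_n ka_k ka_v (fun=> [::]) (fun I => nat_fun (fun _ : 'I_(ka_k I) => 1))
    (fun I => nat_fun (fun _ : 'I_(ka_k I) => (ka_n I).+1))
    (fun I => kASHG_has_IR (ka_k I) (ka_v I)).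
  - exact: comp_const.
  - by rewrite /nB; comp_tac.
  - by rewrite /nat_fun; case: insub.
  - by rewrite (nat_funE _ (Ordinal hl)); case: B xB => // B _; rewrite minnC /minn; case: B.
  - have nx := n_le_size (isT : all no_sep [::]) xB.
    by rewrite (nat_funE _ (Ordinal hl)) (nB_game (isT : all no_sep [::]) xB); lia.
  - by rewrite kASHG_SCC SCC_valid.
  - have kn : ka_k I <= ka_n I.
      rewrite -[ka_k I]card_ord -[ka_n I]card_ord.
      apply: leq_trans (leq_image_card F predT).
      by apply/subset_leq_card/subsetP => j _; have [i <-] := hF j; apply: codom_f.
    apply: leq_trans kn _; exact: n_le_size (isT : all no_sep [::]) (ltnSn _).
  by exists M, c; split=> // I; rewrite enc_kASHGE; apply: hM.
have [F hF|F hF|I|I l|I B l xB hl|I B l xB hl|I|I _|M [c [wfM hM]]] :=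
  @decide_games (bound_fieldB 2) (bound_fieldB 3)
  ASHG_SCC sc_n sc_k sc_v (fun I => bound_words (sc_lb I) (sc_ub I))
  (fun I => nat_fun (sc_lb I)) (fun I => nat_fun (sc_ub I))
  (fun I => SCC_has_IR (sc_v I) (sc_lb I) (sc_ub I)).
- exact: comp_bound_field.
- exact: comp_bound_field.
- exact: no_sep_bound_words.
- by rewrite /nat_fun; case: insub => // l'; apply: sc_lbub.
- exact: (bound_fieldBE xB (c := 0)).
- exact: (bound_fieldBE xB (c := 1)).
- exact: SCC_valid.
(* Each coalition contributes two fields to the input, so [k] is at most the input length in every
   instance. *)
- have := words_le_size (sc_k I) (sc_v I) (bound_words (sc_lb I) (sc_ub I)).
  by rewrite size_bound_words; lia.
by exists M, c; split=> // I; rewrite enc_SCCE; apply: hM.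
Qed.
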